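(* There exists a constant $C_{7}(\alpha)$ depending on $\alpha$ such that for all $n$ sufficiently large, $$d_{Kol}\left( \sqrt{\frac{1-\alpha^2}{1+ \alpha^2}}\, \sqrt{n}\, \theta_n , \, \mathcal{N}(0,1) \right) \leq C_{7}(\alpha) \, \frac{ \sqrt{ \ln n}}{\sqrt{n}}.$$ In particular, $\sqrt{n}\, \theta_n$ converges in distribution to $\mathcal{N}\left( 0, (1+ \alpha^2)/(1- \alpha^2) \right)$ as $n \rightarrow \infty$.
   Context: Let $\alpha\in\mathbb{R}$ with $|\alpha|<1$, and let $\xi_1,\xi_2,\dots,\eta_1,\eta_2,\dots$ be independent standard normal random variables. Define $X_0=Y_0=0$ and $X_n=\alpha X_{n-1}+\xi_n$, $Y_n=\alpha Y_{n-1}+\eta_n$ for $n\ge 1$. Put $Z_{11}^n=\frac1n\sum_{i=1}^n X_i^2-\frac1{n^2}\left(\sum_{i=1}^n X_i\right)^2$, $Z_{22}^n=\frac1n\sum_{i=1}^n Y_i^2-\frac1{n^2}\left(\sum_{i=1}^n Y_i\right)^2$, $Z_{12}^n=\frac1n\sum_{i=1}^n X_iY_i-\frac1{n^2}\left(\sum_{i=1}^n X_i\right)\left(\sum_{i=1}^n Y_i\right)$, and $\theta_n=Z_{12}^n/\sqrt{Z_{11}^nZ_{22}^n}$ (the empirical correlation). $d_{Kol}(X,Y)=\sup_{z\in\mathbb{R}}|P(X\le z)-P(Y\le z)|$ (Kolmogorov distance between laws); $\mathcal N(0,1)$ stands for a standard normal random variable. *)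

(* Defs.v *)
From HB Require Import structures.
From mathcomp Require Import all_boot all_order all_algebra finmap.
From mathcomp Require Import all_classical all_reals all_analysis measurable_realfun.

Set Implicit Arguments.
Unset Strict Implicit.
Unset Printing Implicit Defensive.

Import Order.TTheory GRing.Theory Num.Theory.
Import numFieldNormedType.Exports.

Local Open Scope classical_set_scope.
Local Open Scope ring_scope.

Section distances.
Variable R : realType.
(* Laws on R are given as set functions: [distribution P X] is a measure on R
   with its default measurable structure, whereas [normal_prob m s] is one on
   [measurableTypeR R], the same sigma-algebra with a different display. *)
Implicit Types mu nu : set R -> \bar R.

Definition dKol mu nu : \bar R :=
  ereal_sup (range (fun z : R => `|mu `]-oo, z]%classic - nu `]-oo, z]%classic|%E)).

Definition cvg_in_distribution (mu_ : nat -> set R -> \bar R) nu : Prop :=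
  forall z : R, {for z, continuous (fun x : R => nu `]-oo, x]%classic)} ->
    mu_ n `]-oo, z]%classic @[n --> \oo] --> nu `]-oo, z]%classic.

End distances.

Section random_variables.
Context {d : measure_display} {T : measurableType d} {R : realType}.
Variable P : probability T R.

Definition mutually_independent (I : choiceType) (X : I -> {RV P >-> R}) : Prop :=
  forall (J : {fset I}) (B : I -> set R), (forall i, measurable (B i)) ->
    P (\bigcap_(i in [set` J]) (X i @^-1` B i)) =
    (\prod_(i <- J) P (X i @^-1` B i))%E.

(* Equality is only required on Borel sets: both sides are functions defined on
   all subsets of R, with meaningless values outside the Borel sigma-algebra. *)
Definition has_law (X : {RV P >-> R}) (mu : set R -> \bar R) : Prop :=
  forall B : set R, measurable B -> distribution P X B = mu B.

Definition both_families (xi eta : nat -> {RV P >-> R}) (k : nat + nat)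
    : {RV P >-> R} :=
  match k with inl i => xi i | inr j => eta j end.

End random_variables.

Arguments mutually_independent {d T R} P {I} X.
Arguments has_law {d T R} P X mu.

Section sample_paths.
Context {R : realType}.

(* The noise sequence is indexed from 0: [e k] is the innovation of step k+1. *)
Fixpoint ar1 (alpha : R) (e : nat -> R) (n : nat) : R :=
  if n is k.+1 then alpha * ar1 alpha e k + e k else 0.

Definition emp_cov (n : nat) (x y : nat -> R) : R :=
  n%:R^-1 * (\sum_(1 <= i < n.+1) x i * y i)
  - n%:R ^- 2 * ((\sum_(1 <= i < n.+1) x i) * (\sum_(1 <= i < n.+1) y i)).

(* Equal to 0 when the denominator vanishes, since 0^-1 = 0. *)
Definition emp_corr (n : nat) (x y : nat -> R) : R :=
  emp_cov n x y / Num.sqrt (emp_cov n x x * emp_cov n y y).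

End sample_paths.

Section empirical_correlation.
Context {d : measure_display} {T : measurableType d} {R : realType}.
Implicit Types (alpha : R) (xi eta : nat -> {mfun T >-> R}).

Definition theta alpha xi eta (n : nat) (t : T) : R :=
  emp_corr n (ar1 alpha (xi ^~ t)) (ar1 alpha (eta ^~ t)).

Lemma measurable_ar1 alpha xi n :
  measurable_fun [set: T] (fun t => ar1 alpha (xi ^~ t) n).
Proof.
elim: n => [|n IHn] /=; first exact: measurable_cst.
by apply: measurable_funD => //; apply: measurable_funM.
Qed.

Lemma measurable_emp_cov n (x y : nat -> T -> R) :
  (forall i, measurable_fun [set: T] (x i)) ->
  (forall i, measurable_fun [set: T] (y i)) ->
  measurable_fun [set: T] (fun t => emp_cov n (x ^~ t) (y ^~ t)).
Proof.
move=> mx my; apply: measurable_funB; apply: measurable_funM => //.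
  by apply: measurable_sum => i; apply: measurable_funM.
by apply: measurable_funM; exact: measurable_sum.
Qed.

Lemma measurable_theta alpha xi eta n :
  measurable_fun [set: T] (theta alpha xi eta n).
Proof.
pose X i t := ar1 alpha (xi ^~ t) i; pose Y i t := ar1 alpha (eta ^~ t) i.
have mX i : measurable_fun setT (X i) by exact: measurable_ar1.
have mY i : measurable_fun setT (Y i) by exact: measurable_ar1.
apply: measurable_funM; first exact: (measurable_emp_cov n mX mY).
under eq_fun do rewrite -powR_inv1 ?sqrtr_ge0//.
apply: (measurableT_comp (measurable_powR _)).
apply: measurableT_comp.
  by apply: continuous_measurable_fun; exact: sqrt_continuous.
by apply: measurable_funM;
  [exact: (measurable_emp_cov n mX mX)|exact: (measurable_emp_cov n mY mY)].
Qed.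

HB.instance Definition _ alpha xi eta n :=
  isMeasurableFun.Build _ _ T R (theta alpha xi eta n)
    (measurable_theta alpha xi eta n).

End empirical_correlation.

(* Main.v *)
Require Import Defs.
From HB Require Import structures.
From mathcomp Require Import all_boot all_order all_algebra.
From mathcomp Require Import all_classical all_reals all_analysis.
From mathcomp Require Import finmap measurable_realfun ring lra.
Import Order.TTheory GRing.Theory Num.Theory.
Import numFieldNormedType.Exports.
Local Open Scope classical_set_scope.
Local Open Scope ring_scope.

Set Implicit Arguments.
Unset Strict Implicit.
Unset Printing Implicit Defensive.

(** The numerator of the empirical correlation is exactly Gaussian once the first
path is known, so no central limit theorem is involved, only a law of large
numbers with a rate.

Summation by parts ([ar1_duality]) turns n Z12 = sum_i (X_i - mean X) Y_i into
U = sum_k A_k eta_k, where the weights A_k ([centered_weight]) are obtained from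
the centred first path by running the recursion backwards, and depend on xi
only. Hence U / sqrt Q, with Q = sum_k A_k^2, is standard normal where Q > 0: this is
[gaussian_mixture]. With beta = 1 - alpha^2, the normalized correlation equals
rho * (U / sqrt Q), where
  rho^2 = (beta^3 (Q / n) / (1 + alpha^2)) / ((beta Z11) (beta Z22))
([emp_corr_ratio]). Multiplying a standard normal variable by a random factor
that stays within delta of 1 outside an event of probability p moves its
distribution function by O(delta + p), because the normal distribution function
is Lipschitz under dilations ([normal_cdf_dilation], [kolmogorov_perturbation]).
So it suffices that beta Z11, beta Z22 and beta^3 (Q / n) / (1 + alpha^2) are
within C eps of 1, for eps = sqrt (ln n / n), outside an event of probability
O(1 / n).

These three statistics are quadratic in the noise, but the recursion
x_{i+1} = alpha x_i + e_i reduces each of them to sum_i e_i^2, which is close to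
n, plus the martingales sum_i x_i e_i and sum_i v_i e_i (v being the recursion
driven by x) and boundary terms ([ar1_sum_sqr], [ar1_sum_cross],
[ar1_adjoint_sum_sqr]). For predictable H the process
exp (l sum_i H_i e_i - l^2 / 2 sum_i H_i^2) has expectation at most 1
([exp_supermartingale]); with l = eps, Markov's inequality bounds |sum_i H_i e_i|
by eps / 2 * sum_i H_i^2 + 2 n eps with probability 1 - O(n^-2). Demanding
polynomially small failure probabilities is what costs the factor sqrt (ln n).
The quadratic variation sum_i x_i^2 is the very statistic under study, and the
small factor eps / 2 lets it be absorbed ([sum_sqr_le]). *)

(** * Gaussian integrals *)

Section gauss.
Variable R : realType.
Notation mu := (@lebesgue_measure R).

(** The density and the Radon-Nikodym derivative agree almost everywhere, so the
change of variables known for the latter holds for the former. *)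
Lemma integral_normal_prob (m s : R) (f : measurableTypeR R -> \bar R) :
  measurable_fun setT f -> (forall x, 0 <= f x)%E ->
  (\int[normal_prob m s]_x f x = \int[mu]_x (f x * (normal_pdf m s x)%:E))%E.
Proof.
move=> mf f0.
have mp : measurable_fun setT (fun x => (normal_pdf m s x)%:E).
  by apply/measurable_EFinP; exact: measurable_normal_pdf.
have dom := normal_prob_dominates m s.
have ig := Radon_Nikodym_SigmaFinite.f_integrable dom.
rewrite -(Radon_Nikodym_SigmaFinite.change_of_variables dom)//.
apply: ge0_ae_eq_integral => //.
- by apply: emeasurable_funM => //; exact: measurable_int ig.
- exact: emeasurable_funM.
- by move=> x _; rewrite mule_ge0// Radon_Nikodym_SigmaFinite.f_ge0.
- by move=> x _; rewrite mule_ge0// lee_fin normal_pdf_ge0.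
- apply: ae_eqe_mul2l; apply: integral_ae_eq => // E _ mE.
  by rewrite -(Radon_Nikodym_SigmaFinite.f_integral dom).
Qed.

Lemma normal_prob_affine (c r y : R) : 0 < r ->
  normal_prob 0 1 [set u | c + r * u <= y] = normal_prob c r `]-oo, y].
Proof.
move=> r0.
have -> : [set u | c + r * u <= y] = `]-oo, (y - c) / r]%classic.
  by apply/seteqP; split=> u /=; rewrite in_itv/= ler_pdivlMr// lerBrDl mulrC.
pose F := (fun v : R^o => (v - c) / r : R^o).
have dF x : derivable F x 1 by [].
have F'E : F^`()%classic = cst r^-1.
  apply/funext => x; rewrite /F derive1E deriveM// deriveD// derive_cst scaler0.
  by rewrite add0r derive_id derive_cst addr0 scaler1.
have FyE : F y = (y - c) / r by [].
rewrite /normal_prob -FyE.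
rewrite (@increasing_ge0_integration_by_substitutionNy _ F (normal_pdf 0 1) y).
- apply: eq_integral => x _.
  rewrite F'E /= !normal_pdfE ?gt_eqF ?ltr01//= /normal_peak /normal_fun/=.
  rewrite !fctE; congr (_%:E).
  rewrite subr0 expr1n mul1r -[in RHS]mulrnAr sqrtrM ?sqr_ge0// sqrtr_sqr gtr0_norm//.
  have -> : - F x ^+ 2 / 2 = - (x - c) ^+ 2 / (r ^+ 2 *+ 2).
    by rewrite /F; field; rewrite gt_eqF.
  by rewrite invfM mulrC mulrA.
- move=> u v _ _ uv; rewrite /F ltr_pM2r ?invr_gt0// ltrD2r//.
- by rewrite F'E => ? _; exact: cvg_cst.
- by rewrite F'E; exact: is_cvg_cst.
- by rewrite F'E; exact: cvg_cst.
- split=> [x _|]; first exact: dF.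
  apply: cvg_at_left_filter.
  by apply: differentiable_continuous; apply/derivable1_diffP.
- apply/gt0_cvgMlNy; first by rewrite invr_gt0.
  exact: cvg_addrr_Ny.
- apply: continuous_subspaceT; apply: continuous_normal_pdf; exact: oner_neq0.
- by move=> x _; exact: normal_pdf_ge0.
Qed.

(** Completing the square: the joint density of the noise [x] and of
[v = a x + r u] factors as the density of [v] times the conditional density of
[x] given [v]. *)
Lemma normal_pdf_convolution (a r v x : R) : 0 < r ->
  normal_pdf (a * x) r v * normal_pdf 0 1 x =
  normal_pdf 0 (Num.sqrt (r ^+ 2 + a ^+ 2)) v *
  normal_pdf (a * v / (r ^+ 2 + a ^+ 2)) (r / Num.sqrt (r ^+ 2 + a ^+ 2)) x.
Proof.
move=> r0; set q := r ^+ 2 + a ^+ 2.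
have q0 : 0 < q by rewrite ltr_wpDr ?sqr_ge0// exprn_gt0.
set s := Num.sqrt q.
have s0 : 0 < s by rewrite sqrtr_gt0.
have s2 : s ^+ 2 = q by rewrite sqr_sqrtr// ltW.
have rs0 : 0 < r / s by rewrite divr_gt0.
rewrite !normal_pdfE ?gt_eqF ?ltr01//= /normal_peak /normal_fun.
rewrite mulrACA [RHS]mulrACA -!expRD; congr (_ * expR _).
  have pos (t : R) : 0 <= t ^+ 2 * pi *+ 2.
    by rewrite mulrn_wge0// mulr_ge0 ?sqr_ge0// pi_ge0.
  rewrite -!invfM -!sqrtrM ?pos//.
  congr (_^-1); congr Num.sqrt; rewrite exprMn exprVn s2.
  by field; rewrite gt_eqF.
rewrite !exprMn exprVn s2 /q.
by field; rewrite !gt_eqF//.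
Qed.

(** Integrating the factorization above over [x] first leaves the density of
a centred normal variable of variance [r ^+ 2 + a ^+ 2]. *)
Lemma normal_prob_convolution_gt0 (a r y : R) : 0 < r ->
  (\int[normal_prob 0 1]_x normal_prob 0 1 [set u | (a * x + r * u <= y)%R] =
  normal_prob 0 1 [set u | (Num.sqrt (r ^+ 2 + a ^+ 2) * u <= y)%R])%E.
Proof.
move=> r0.
have q0 : 0 < r ^+ 2 + a ^+ 2 by rewrite ltr_wpDr ?sqr_ge0// exprn_gt0.
set s := Num.sqrt _.
have s0 : 0 < s by rewrite sqrtr_gt0.
under eq_integral do rewrite normal_prob_affine//.
rewrite -[X in normal_prob 0 1 X](_ : [set u | 0 + s * u <= y] = _); last first.
  by apply/seteqP; split=> u /=; rewrite add0r.
rewrite normal_prob_affine//.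
pose D : set (measurableTypeR R) := `]-oo, y]%classic.
pose G (z : measurableTypeR R * measurableTypeR R) : \bar R :=
  ((normal_pdf (a * z.1) r z.2 * \1_D z.2) * normal_pdf 0 1 z.1)%:E.
have G0 z : (0 <= G z)%E.
  by rewrite lee_fin !mulr_ge0 ?normal_pdf_ge0// indicE ler0n.
have mD : measurable_fun setT (\1_D : measurableTypeR R -> R).
  by apply: measurable_indic; exact: measurable_itv.
pose H (z : measurableTypeR R * measurableTypeR R) : R :=
  normal_pdf (a * z.1) r z.2 * \1_D z.2.
have mpdf : measurable_fun setT H.
  apply: measurable_funM; last first.
    exact: (measurableT_comp mD measurable_snd).
  rewrite (_ : (fun z => _) = fun z => normal_peak r * normal_fun (a * z.1) r z.2).
    apply: measurable_funM => //; apply: measurableT_comp => //.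
    apply: measurable_funM => //; apply: measurableT_comp => //.
    by apply: measurable_funX; apply: measurable_funB => //; exact: measurable_funM.
  by apply/funext => z; rewrite normal_pdfE// gt_eqF.
have mG : measurable_fun setT G.
  apply/measurable_EFinP; apply: measurable_funM => //.
  by apply: measurableT_comp; [exact: measurable_normal_pdf|exact: measurable_fst].
have E1 x : normal_prob (a * x) r D = (\int[mu]_v (normal_pdf (a * x) r v * \1_D v)%:E)%E.
  rewrite /normal_prob integral_mkcond epatch_indic.
  by apply: eq_integral.
rewrite integral_normal_prob; last 2 first.
- apply: (eq_measurable_fun _ _
    (measurable_fun_fubini_tonelli_F (m2 := mu) (EFin \o H) _ _)).
  + by move=> x _; rewrite E1.
  + exact/measurable_EFinP.
  + by move=> z; rewrite lee_fin mulr_ge0 ?normal_pdf_ge0// indicE ler0n.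
- by move=> x.
transitivity (\int[mu]_x \int[mu]_v G (x, v))%E.
  apply: eq_integral => x _; rewrite E1 -ge0_integralZr//.
  - by apply/measurable_EFinP; exact: (measurable_fun_pair2 x mpdf).
  - by move=> v _; rewrite lee_fin mulr_ge0 ?normal_pdf_ge0// indicE ler0n.
  - by rewrite lee_fin normal_pdf_ge0.
rewrite (fubini_tonelli G)// [RHS]/normal_prob [RHS]integral_mkcond epatch_indic.
apply: eq_integral => v _.
transitivity (\int[mu]_x ((normal_pdf 0 s v * \1_D v)%:E *
    (normal_pdf (a * v / (r ^+ 2 + a ^+ 2)) (r / s) x)%:E))%E.
  apply: eq_integral => x _; rewrite /G/= -EFinM; congr EFin.
  by rewrite mulrAC normal_pdf_convolution// mulrAC.
rewrite ge0_integralZl//.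
- by rewrite integral_normal_pdf mule1.
- by apply/measurable_EFinP; exact: measurable_normal_pdf.
- by move=> x _; rewrite lee_fin normal_pdf_ge0.
- by rewrite lee_fin mulr_ge0 ?normal_pdf_ge0// indicE ler0n.
Qed.
End gauss.

Section gauss2.
Variable R : realType.
Notation mu := (@lebesgue_measure R).
Implicit Types (a l r u x y z w : R).

Lemma normal_probN (A : set (measurableTypeR R)) : measurable A ->
  normal_prob 0 1 [set x | A (- x)] = normal_prob 0 1 A.
Proof.
move=> mA; rewrite /normal_prob.
have mp : measurable_fun A (fun x : measurableTypeR R => (normal_pdf 0 1 x)%:E).
  by apply: measurable_funTS; apply/measurable_EFinP; exact: measurable_normal_pdf.
rewrite [RHS](_ : _ = \int[pushforward mu (-%R : _ -> measurableTypeR R)]_(x in A)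
    (normal_pdf 0 1 x)%:E)%E; last first.
  by apply: eq_measure_integral => //= B mB _; exact/esym/lebesgue_measureN.
have mN : measurable_fun setT (-%R : measurableTypeR R -> measurableTypeR R).
  exact: (@oppr_measurable R setT).
rewrite (ge0_integral_pushforward mN _ mA mp); last first.
  by move=> x _; rewrite lee_fin normal_pdf_ge0.
apply: eq_integral => x _ /=; rewrite !normal_pdfE ?oner_eq0//= /normal_fun.
by rewrite !subr0 sqrrN.
Qed.

(** The case [r = 0] is included because in the induction of [gaussian_mixture]
the remaining variance vanishes at the last step. *)
Lemma normal_prob_convolution a r w y : 0 <= r ->
  (\int[normal_prob 0 1]_x normal_prob 0 1 [set u | (w + a * x + r * u <= y)%R] =
  normal_prob 0 1 [set u | (w + Num.sqrt (r ^+ 2 + a ^+ 2) * u <= y)%R])%E.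
Proof.
move=> r_ge0.
have shift (f : R -> R) : [set u | w + f u <= y] = [set u | f u <= y - w].
  by apply/seteqP; split=> u /=; rewrite lerBrDl.
have shift2 x (f : R -> R) : [set u | w + a * x + f u <= y] = [set u | a * x + f u <= y - w].
  by apply/seteqP; split=> u /=; rewrite lerBrDl addrA.
rewrite shift; under eq_integral do rewrite shift2.
move: {w y shift shift2} (y - w) => y.
move: r_ge0; rewrite le_eqVlt => /predU1P[<-|r0]; last exact: normal_prob_convolution_gt0.
rewrite expr0n add0r sqrtr_sqr.
have mA b : measurable ([set u : measurableTypeR R | b * u <= y]).
  rewrite -[X in measurable X]setTI; exact: measurable_fun_le.
transitivity (\int[normal_prob 0 1]_x (\1_[set u | (a * u <= y)%R] x)%:E)%E.
  apply: eq_integral => x _; rewrite indicE.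
  have [ay|ay] := boolP (a * x <= y).
    rewrite mem_set// [X in normal_prob _ _ X](_ : _ = setT).
      exact: (@probability_setT _ _ _ (normal_prob 0 1)).
    by apply/seteqP; split=> u //= _; rewrite mul0r addr0.
  rewrite memNset/=; last exact/negP.
  rewrite [X in normal_prob _ _ X](_ : _ = set0) ?measure0//.
  by apply/seteqP; split=> u //=; rewrite mul0r addr0 (negbTE ay).
rewrite integral_indic ?setIT; [|exact: measurableT|exact: mA].
have [a0|a0] := ger0P a => //.
rewrite -(normal_probN (mA (- a))).
by congr (normal_prob _ _ _); apply/seteqP; split=> u /=; rewrite mulrNN.
Qed.

Lemma normal_mgf a :
  (\int[normal_prob 0 1]_x (expR (a * x - a ^+ 2 / 2))%:E = 1)%E.
Proof.
rewrite integral_normal_prob//; last first.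
  apply/measurable_EFinP; apply: measurableT_comp => //.
  by apply: measurable_funB => //; exact: measurable_funM.
rewrite -(@integral_normal_pdf _ a 1); apply: eq_integral => x _.
rewrite -EFinM !normal_pdfE ?oner_eq0//= mulrCA; congr ((_ * _)%:E).
by rewrite /normal_fun -expRD; congr expR; field.
Qed.

(** Squaring reduces this to [(1 + t) * (1 - u) >= 1] with
[t = u + 2 * u ^+ 2], since [expR t >= 1 + t]. *)
Lemma inv_sqrt_le_expR u : `|u| <= 2^-1 ->
  (Num.sqrt (1 - u))^-1 <= expR (u / 2 + u ^+ 2).
Proof.
move=> hu; have [h1 h2] : - 2^-1 <= u /\ u <= 2^-1 by apply/andP; rewrite -ler_norml.
have p0 : 0 < 1 - u by lra.
have s0 : 0 < Num.sqrt (1 - u) by rewrite sqrtr_gt0.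
rewrite invf_ple ?posrE ?expR_gt0// -expRN.
rewrite -(@ler_pXn2r _ 2) ?nnegrE ?expR_ge0 ?sqrtr_ge0//.
rewrite (sqr_sqrtr (ltW p0)) -expRM_natl.
rewrite mulrN expRN invf_ple ?posrE ?expR_gt0//.
rewrite (le_trans _ (expR_ge1Dx _))// -[leLHS]mul1r ler_pdivrMr//.
nra.
Qed.

(** The exact value is [expR (- l - 4 * l ^+ 2) / Num.sqrt (1 - 2 * l)]: the
integrand is a multiple of a centred normal density. *)
Lemma normal_mgf_sqr l : `|l| <= 4^-1 ->
  (\int[normal_prob 0 1]_x (expR (l * (x ^+ 2 - 1) - 4 * l ^+ 2))%:E <= 1)%E.
Proof.
move=> hl; have [h1 h2] : - 4^-1 <= l /\ l <= 4^-1 by apply/andP; rewrite -ler_norml.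
have p0 : 0 < 1 - 2 * l by lra.
set s := (Num.sqrt (1 - 2 * l))^-1.
have s0 : 0 < s by rewrite invr_gt0 sqrtr_gt0.
have s2 : s ^+ 2 = (1 - 2 * l)^-1 by rewrite exprVn (sqr_sqrtr (ltW p0)).
rewrite integral_normal_prob//; last first.
  apply/measurable_EFinP; apply: measurableT_comp => //.
  apply: measurable_funB => //; apply: measurable_funM => //.
  by apply: measurable_funB => //; exact: measurable_funX.
rewrite (_ : (fun x => _) = fun x => ((s * expR (- (l + 4 * l ^+ 2)))%:E * (normal_pdf 0 s x)%:E)%E).
  rewrite ge0_integralZl//.
  - rewrite integral_normal_pdf mule1 lee_fin expRN ler_pdivrMr ?expR_gt0// mul1r.
    have -> : l + 4 * l ^+ 2 = (2 * l) / 2 + (2 * l) ^+ 2 by field.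
    apply: inv_sqrt_le_expR; rewrite normrM ger0_norm//; lra.
  - by apply/measurable_EFinP; exact: measurable_normal_pdf.
  - by move=> x _; rewrite lee_fin normal_pdf_ge0.
  - by rewrite lee_fin mulr_ge0 ?expR_ge0// ltW.
apply/funext => x; rewrite -!EFinM !normal_pdfE ?oner_eq0 ?gt_eqF//=; congr (_%:E).
rewrite /normal_peak /normal_fun !subr0.
rewrite expr1n mul1r -[in RHS]mulrnAr [in RHS]sqrtrM ?sqr_ge0// sqrtr_sqr gtr0_norm//.
rewrite [in RHS]invfM.
have -> : - x ^+ 2 / (s ^+ 2 *+ 2) = l * x ^+ 2 - x ^+ 2 / 2.
  by rewrite s2; field; rewrite gt_eqF.
have -> : l * (x ^+ 2 - 1) - 4 * l ^+ 2 = l * x ^+ 2 - (l + 4 * l ^+ 2) by ring.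
rewrite !expRD; have -> : - x ^+ 2 / (1 *+ 2) = - (x ^+ 2 / 2) by field.
have p1 : 0 < Num.sqrt (pi *+ 2 : R) by rewrite sqrtr_gt0 mulrn_wgt0// pi_gt0.
by field; rewrite !gt_eqF.
Qed.

End gauss2.

(** * The normal distribution function *)

Section cdf.
Variable R : realType.
Notation mu := (@lebesgue_measure R).
Implicit Types (a b t s z M : R).

Definition normal_cdf z : R := fine (normal_prob 0 1 `]-oo, z]).

Lemma normal_cdfE z : (normal_cdf z)%:E = normal_prob 0 1 `]-oo, z].
Proof. by rewrite fineK// fin_num_measure. Qed.

Lemma normal_prob_scale s z : 0 < s ->
  normal_prob 0 s `]-oo, z] = (normal_cdf (z / s))%:E.
Proof.
move=> s0; rewrite -normal_prob_affine// normal_cdfE; congr (normal_prob _ _ _).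
by apply/seteqP; split=> u /=; rewrite in_itv/= add0r ler_pdivlMr// mulrC.
Qed.

Lemma normal_cdf_le a b : a <= b -> normal_cdf a <= normal_cdf b.
Proof.
move=> ab; rewrite -lee_fin !normal_cdfE.
have m z : measurable (`]-oo, z]%classic : set (measurableTypeR R)).
  exact: measurable_itv.
apply: le_measure; [apply: mem_set; exact: m|apply: mem_set; exact: m|].
by move=> x /=; rewrite !in_itv/= => /le_trans; exact.
Qed.

Lemma normal_cdf_increment a b M : a <= b ->
  (forall x, a < x <= b -> normal_pdf 0 1 x <= M) ->
  normal_cdf b - normal_cdf a <= M * (b - a).
Proof.
move=> ab hM; rewrite lerBlDl -lee_fin EFinD !normal_cdfE.
have -> : `]-oo, b]%classic = `]-oo, a]%classic `|` `]a, b]%classic.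
  by rewrite -itv_bndbnd_setU// bnd_simp.
rewrite [leLHS]measureU//=; last first.
  apply/seteqP; split=> x //=; rewrite !in_itv/= => -[xa /andP[ax _]].
  by move: (lt_le_trans ax xa); rewrite ltxx.
rewrite leeD2l// /normal_prob.
have -> : (M * (b - a))%:E = (\int[mu]_(x in `]a, b]) (cst M%:E x))%E.
  rewrite integral_cst//= lebesgue_measure_itv/= lte_fin; move: ab.
  by rewrite le_eqVlt => /predU1P[->|->//]; rewrite ltxx subrr mulr0 mule0.
apply: ge0_le_integral => //=.
- by move=> x _; rewrite lee_fin normal_pdf_ge0.
- by apply: measurable_funTS; apply/measurable_EFinP; exact: measurable_normal_pdf.
Qed.

Lemma normal_pdf_mono a b : `|a| <= `|b| -> normal_pdf 0 1 b <= normal_pdf (0:R) 1 a.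
Proof.
move=> ab; rewrite !normal_pdfE ?oner_eq0//= /normal_fun !subr0.
rewrite ler_wpM2l ?normal_peak_ge0// ler_expR !mulNr lerN2 ler_wpM2r ?invr_ge0//.
by rewrite -[a ^+ 2]real_normK ?num_real// -[b ^+ 2]real_normK ?num_real// ler_pXn2r ?nnegrE.
Qed.

(** [expR (z ^+ 2 / 2) >= 1 + z ^+ 2 / 2 >= `|z|], and the peak of the density is
at most 1. *)
Lemma normal_pdf_tail z : `|z| * normal_pdf 0 1 z <= 1.
Proof.
rewrite normal_pdfE ?oner_eq0//= /normal_fun /normal_peak subr0 expr1n mul1r.
have pi1 : 1 <= Num.sqrt (pi *+ 2 : R).
  rewrite -[leLHS]sqrtr1 ler_wsqrtr// mulr2n -[leLHS]addr0 lerD ?pi_ge0//.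
  by rewrite (le_trans _ (pi_ge2 R))// ler1n.
have p0 : 0 < Num.sqrt (pi *+ 2 : R) by rewrite (lt_le_trans ltr01).
rewrite mulrCA ler_pdivrMl// mulr1 (le_trans _ pi1)// mulNr expRN ler_pdivrMr ?expR_gt0// mul1r.
rewrite (le_trans _ (expR_ge1Dx _))// -real_normK ?num_real//.
nra.
Qed.

(** Between [z] and [t * z] the density is at most its value at [z], and the
interval has length [(t - 1) * `|z|], which [normal_pdf_tail] compensates. *)
Lemma normal_cdf_dilation t z : 1 <= t ->
  `|normal_cdf (t * z) - normal_cdf z| <= t - 1.
Proof.
move=> t1.
have t0 : 0 <= t by rewrite (le_trans ler01).
have key : `|z| * (t - 1) * normal_pdf 0 1 z <= t - 1.
  by rewrite mulrAC -[leRHS]mul1r ler_wpM2r ?subr_ge0// normal_pdf_tail.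
have [z0|z0] := leP 0 z.
  have zt : z <= t * z by rewrite ler_peMl.
  rewrite ger0_norm ?subr_ge0 ?normal_cdf_le//.
  rewrite (le_trans (@normal_cdf_increment _ _ (normal_pdf 0 1 z) zt _))//.
    move=> x /andP[zx _]; apply: normal_pdf_mono.
    by rewrite !ger0_norm// ?ltW// (le_lt_trans z0).
  by move: key; rewrite ger0_norm// mulrC (_ : t * z - z = z * (t - 1))//; ring.
have zt : t * z <= z by rewrite ler_neMl// ltW.
rewrite distrC ger0_norm ?subr_ge0 ?normal_cdf_le//.
rewrite (le_trans (@normal_cdf_increment _ _ (normal_pdf 0 1 z) zt _))//.
  move=> x /andP[_ xz]; apply: normal_pdf_mono.
  by rewrite !ler0_norm ?lerN2// ?ltW// (le_lt_trans xz).
by move: key; rewrite ltr0_norm// mulrC (_ : z - t * z = - z * (t - 1))//; ring.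
Qed.

End cdf.

(** * Independent Gaussian families: conditioning and deviation bounds *)

Section freezing.
Context d (T : measurableType d) (R : realType) (P : probability T R).
Variables (K : choiceType) (X : K -> {RV P >-> R}).
Implicit Types (I : set K) (J : {fset K}) (B : K -> set R) (k : K).

(** The finite-dimensional events of the variables indexed by [I]. They form a
pi-system, on which independence is given by hypothesis. *)
Definition cylinders I : set (set T) :=
  [set A | exists J B, [/\ [set` J] `<=` I, (forall i, measurable (B i)) &
                           A = \bigcap_(i in [set` J]) (X i @^-1` B i)]].

(** The sample space with the sigma-algebra generated by the variables indexed
by [I]: measurability on [past I] means being a function of these variables. *)
Definition past I : measurableType _ := g_sigma_algebraType (cylinders I).

Lemma measurable_preimage i (D : set R) : measurable D -> measurable (X i @^-1` D).
Proof. by move=> mD; rewrite -[_ @^-1` _]setTI; exact: measurable_funP. Qed.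

Lemma cylinders_measurable I : cylinders I `<=` measurable.
Proof.
move=> _ [J [B [_ mB ->]]].
by apply: fin_bigcap_measurable => // i _; exact: measurable_preimage.
Qed.

Lemma cylinders_setI I : setI_closed (cylinders I).
Proof.
move=> _ _ [J1 [B1 [J1I mB1 ->]]] [J2 [B2 [J2I mB2 ->]]].
pose trunc J B i := if i \in J then B i else setT.
exists (J1 `|` J2)%fset, (fun i => trunc J1 B1 i `&` trunc J2 B2 i); split.
- by move=> i /=; rewrite in_fsetU => /orP[/J1I|/J2I].
- by move=> i; apply: measurableI; rewrite /trunc; case: ifP.
- apply/seteqP; split=> t /=.
    by move=> [h1 h2] i _; split; rewrite /trunc; case: ifP => // ij; [exact: h1|exact: h2].
  move=> h; split=> i /= ij.
    by have /= := h i; rewrite in_fsetU ij /= => /(_ isT)[]; rewrite /trunc ij.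
  by have /= := h i; rewrite in_fsetU ij orbT /= => /(_ isT)[_]; rewrite /trunc ij.
Qed.

Lemma cylinders_setT I : cylinders I setT.
Proof.
exists fset0, (fun=> setT); split=> //.
by apply/seteqP; split.
Qed.

Lemma past_measurable I (A : set T) : measurable (A : set (past I)) -> measurable A.
Proof.
apply: (@smallest_sub _ (sigma_algebra setT) (cylinders I) measurable).
  exact: sigma_algebra_measurable.
exact: cylinders_measurable.
Qed.

Lemma measurable_past I i : I i -> measurable_fun setT (X i : past I -> R).
Proof.
move=> Ii _ D mD; rewrite setTI; apply: sub_sigma_algebra.
exists [fset i]%fset, (fun=> D); split=> //.
  by move=> j /=; rewrite inE => /eqP ->.
apply/seteqP; split=> t /=; first by move=> h j /=; rewrite inE => /eqP ->.
by apply; rewrite /= inE.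
Qed.

Lemma past_subset I I' : I `<=` I' ->
  measurable_fun setT (idfun : past I' -> past I).
Proof.
move=> II' _ A mA; rewrite setTI.
move: A mA; apply: sub_sigma_algebra2 => A [J [B [JI mB ->]]].
by exists J, B; split=> //; exact: (subset_trans JI).
Qed.

Lemma past_fun d' (T' : measurableType d') I (f : T -> T') :
  measurable_fun setT (f : past I -> T') -> measurable_fun setT f.
Proof. by move=> mf _ D mD; apply: (@past_measurable I); exact: mf. Qed.

Hypothesis indX : mutually_independent P X.

Lemma independent_cylinder I k (A : set T) (D : set R) : ~ I k -> cylinders I A ->
  measurable D -> P (A `&` X k @^-1` D) = (P A * P (X k @^-1` D))%E.
Proof.
move=> Ik [J [B [JI mB ->]]] mD.
have kJ : k \notin J by apply/negP => /JI.
pose B' i := if i == k then D else B i.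
have mB' i : measurable (B' i) by rewrite /B'; case: ifP.
have B'J i : i \in J -> B' i = B i.
  by rewrite /B'; case: eqP kJ => // -> /negbTE ->.
have := indX (k |` J)%fset mB'.
rewrite big_fsetU1//= {2}/B' eqxx (eq_big_seq (fun i => P (X i @^-1` B i))); last first.
  by move=> i iJ; rewrite B'J.
rewrite -indX// muleC => <-; congr (P _).
apply/seteqP; split=> t /=.
  move=> [h hk] i /=; rewrite in_fset1U => /orP[/eqP ->|iJ]; first by rewrite /B' eqxx.
  by rewrite B'J//; exact: h.
move=> h; split=> [i /= iJ|].
  by have /= := h i; rewrite in_fset1U iJ orbT B'J//; apply.
by have /= := h k; rewrite in_fset1U eqxx /B' eqxx; apply.
Qed.

(** Both sides are finite measures in [A] that agree on the pi-system of
cylinders. *)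
Lemma independent_past I k (A : set (past I)) (D : set R) : ~ I k -> measurable A ->
  measurable D -> P (A `&` X k @^-1` D) = (P A * P (X k @^-1` D))%E.
Proof.
move=> Ik mA mD.
have mk := measurable_preimage k mD.
have p0 : 0 <= fine (P (X k @^-1` D)) by exact: fine_ge0.
pose m2 := mscale (NngNum p0) P.
have m2E (E : set T) : m2 E = (P E * P (X k @^-1` D))%E.
  by rewrite /m2 /mscale/= fineK ?fin_num_measure// muleC.
rewrite -m2E -[LHS]/(mrestr P mk A).
apply: (@g_sigma_algebra_measure_unique _ R T (cylinders I)
  (@cylinders_measurable I) (fun=> setT)) => //.
- by move=> _; exact: cylinders_setT.
- exact: bigcup_const.
- exact: cylinders_setI.
- by move=> E cE; rewrite [RHS]m2E; exact: independent_cylinder cE mD.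
- by move=> _; rewrite /= /mrestr setTI ltey_eq fin_num_measure.
Qed.

(** Conditioning on the past: the law of [(t, X k t)] on
[past I * R] is a product measure, so a new innovation may be integrated out
with the past kept fixed. *)
Lemma freezing I k (F : past I * measurableTypeR R -> \bar R) : ~ I k ->
  has_law P (X k) (normal_prob 0 1) ->
  measurable_fun setT F -> (forall z, 0 <= F z)%E ->
  (\int[P]_t F (t, X k t) = \int[P]_t \int[normal_prob 0 1]_x F (t, x))%E.
Proof.
move=> Ik lawX mF F0.
have mid : measurable_fun setT (idfun : T -> past I).
  by move=> _ A mA; rewrite setTI; exact: (@past_measurable I).
have mX : measurable_fun setT (X k : T -> measurableTypeR R).
  exact: (measurable_funP (X k)).
have mpair : measurable_fun setT (fun t : T => (t : past I, X k t : measurableTypeR R)).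
  exact/measurable_fun_pair.
pose Id : {mfun T >-> past I} :=
  HB.pack (idfun : T -> past I) (isMeasurableFun.Build _ _ _ _ _ mid).
pose m1 : probability _ R := distribution P Id.
pose Y : {mfun T >-> (past I * measurableTypeR R)%type} :=
  HB.pack (fun t : T => (t : past I, X k t : measurableTypeR R))
    (isMeasurableFun.Build _ _ _ _ _ mpair).
transitivity (\int[distribution P Y]_z F z)%E.
  by rewrite ge0_integral_distribution.
transitivity (\int[(m1 \x normal_prob 0 1)]_z F z)%E.
  apply: eq_measure_integral => A mA _; apply/esym.
  apply: product_measure_unique => // A' D mA' mD.
  rewrite -[LHS]/(P (A' `&` X k @^-1` D)) independent_past//.
  by rewrite -[P (X k @^-1` D)]/(distribution P (X k) D) lawX.
rewrite (fubini_tonelli1 F)//.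
rewrite ge0_integral_distribution//; first exact: measurable_fun_fubini_tonelli_F.
by move=> t; apply: integral_ge0 => x _; exact: F0.
Qed.

(** The innovations [X (kappa 0)], [X (kappa 1)], ... are revealed one by one;
[I j] indexes what is known before the [j]-th one. *)
Section supermartingale.
Variables (kappa : nat -> K) (I : nat -> set K).
Hypothesis I_fresh : forall j, ~ I j (kappa j).
Hypothesis I_mono : forall j, I j `<=` I j.+1.
Hypothesis I_next : forall j, I j.+1 (kappa j).
Hypothesis law : forall j, has_law P (X (kappa j)) (normal_prob 0 1).

Section exponential.
Variable f : nat -> T -> R -> R.
Hypothesis mf : forall j,
  measurable_fun setT (fun z : past (I j) * measurableTypeR R => f j z.1 z.2).
Hypothesis f_le1 : forall j t, (\int[normal_prob 0 1]_x (expR (f j t x))%:E <= 1)%E.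

Let S n t := \sum_(j < n) f j t (X (kappa j) t).

Let mS n : measurable_fun setT (S n : past (I n) -> R).
Proof.
elim: n => [|n IH].
  by rewrite (_ : S 0 = cst 0)//; apply/funext => t; rewrite /S big_ord0.
rewrite (_ : S n.+1 = fun t => S n t + f n t (X (kappa n) t)); last first.
  by apply/funext => t; rewrite /S big_ord_recr.
have mid := past_subset (@I_mono n).
apply: measurable_funD; first exact: measurableT_comp IH mid.
have mX : measurable_fun setT (X (kappa n) : past (I n.+1) -> measurableTypeR R).
  exact: (measurable_past (@I_next n)).
exact: (measurableT_comp (@mf n) (measurable_fun_pair mid mX)).
Qed.

(** Integrating out the last innovation does not increase the expectation. *)
Lemma exp_supermartingale n : (\int[P]_t (expR (S n t))%:E <= 1)%E.
Proof.
elim: n => [|n IH].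
  under eq_integral do rewrite /S big_ord0 expR0.
  by rewrite integral_cst// mul1e probability_le1.
apply: le_trans IH.
pose F (z : past (I n) * measurableTypeR R) := (expR (S n z.1) * expR (f n z.1 z.2))%:E.
under eq_integral do rewrite /S big_ord_recr/= expRD.
have mF : measurable_fun setT F.
  apply/measurable_EFinP; apply: measurable_funM.
    by apply: measurableT_comp => //; exact: (measurableT_comp (@mS n) measurable_fst).
  by apply: measurableT_comp.
have F0 z : (0 <= F z)%E by rewrite lee_fin mulr_ge0 ?expR_ge0.
rewrite [leLHS](@freezing (I n) (kappa n) F)//.
apply: ge0_le_integral => //.
- by move=> t _; apply: integral_ge0 => x _; rewrite lee_fin mulr_ge0 ?expR_ge0.
- by apply: (@past_fun _ _ (I n)); exact: measurable_fun_fubini_tonelli_F.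
- by apply/measurable_EFinP; apply: measurableT_comp => //; exact: past_fun (@mS n).
move=> t _; rewrite /F/=; under eq_integral do rewrite EFinM.
rewrite ge0_integralZl//.
- by rewrite -[leRHS]mule1 lee_wpmul2l// lee_fin expR_ge0.
- apply/measurable_EFinP; have mft : measurable_fun setT (f n t : measurableTypeR R -> R).
    exact: (@measurable_fun_pair2 _ _ _ (past (I n)) _ _ _ t (@mf n)).
  exact: (measurableT_comp (@measurable_expR R) mft).
Qed.

Lemma exponential_bound n (s : R) : exists B : set T,
  [/\ measurable B, (P B <= (expR (- s))%:E)%E &
   forall t, ~ B t -> \sum_(j < n) f j t (X (kappa j) t) < s].
Proof.
have mSn : measurable_fun setT (S n) by exact: past_fun (@mS n).
pose Y : {RV P >-> R} := HB.pack (S n) (isMeasurableFun.Build _ _ _ _ _ mSn).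
exists [set t | Y t >= s]; split.
- by rewrite -[X in measurable X]setTI; exact: measurable_fun_le.
- rewrite (le_trans (chernoff _ _ ltr01))// mul1r /mmt_gen_fun unlock.
  rewrite -[leRHS]mul1e lee_wpmul2r ?lee_fin ?expR_ge0//.
  rewrite (le_trans _ (exp_supermartingale n))//=.
  by under eq_integral do rewrite mulr1.
- by move=> t /negP; rewrite -ltNge.
Qed.

End exponential.

(** [normal_mgf] makes [expR (l * M - l ^+ 2 / 2 * Q)] a supermartingale, where
[M] is the sum and [Q] its quadratic variation. The bound is self-normalized:
[Q] is the random quantity itself, not a bound on it. *)
Lemma linear_deviation (H : nat -> T -> R) n (l s : R) : 0 < l ->
  (forall j, measurable_fun setT (H j : past (I j) -> R)) ->
  exists B : set T, [/\ measurable B, (P B <= (2 * expR (- s))%:E)%E &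
    forall t, ~ B t -> `|\sum_(j < n) H j t * X (kappa j) t| <=
      l / 2 * (\sum_(j < n) H j t ^+ 2) + s / l].
Proof.
move=> l0 mH.
(* c = l and c = - l bound the sum from above and from below *)
pose f (c : R) j t x := c * H j t * x - (c * H j t) ^+ 2 / 2.
have mf c j : measurable_fun setT
    (fun z : past (I j) * measurableTypeR R => f c j z.1 z.2).
  have mcH : measurable_fun setT (fun z : past (I j) * measurableTypeR R => c * H j z.1).
    by apply: measurable_funM => //; exact: (measurableT_comp (mH j) measurable_fst).
  apply: measurable_funB; first exact: measurable_funM.
  by apply: measurable_funM => //; exact: measurable_funX.
have f1 c j t : (\int[normal_prob 0 1]_x (expR (f c j t x))%:E <= 1)%E.
  by rewrite normal_mgf.
have [B1 [mB1 PB1 hB1]] := exponential_bound (mf l) (f1 l) n s.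
have [B2 [mB2 PB2 hB2]] := exponential_bound (mf (- l)) (f1 (- l)) n s.
exists (B1 `|` B2); split; first exact: measurableU.
  rewrite (le_trans (measureU2 _ _ _))// mulr2n mulrDl mul1r EFinD.
  by rewrite leeD.
move=> t /not_orP[/hB1 + /hB2].
have fE c : \sum_(j < n) f c j t (X (kappa j) t) =
    c * (\sum_(j < n) H j t * X (kappa j) t) - c ^+ 2 / 2 * (\sum_(j < n) H j t ^+ 2).
  rewrite !mulr_sumr -sumrB; apply: eq_bigr => j _.
  by rewrite /f; ring.
rewrite !fE; set M := \sum_(j < n) _ * _; set Q := \sum_(j < n) _ ^+ 2 => h1 h2.
rewrite ler_norml; apply/andP; split.
  rewrite lerNl -(ler_pM2l l0) mulrDr (mulrCA l s) divff ?gt_eqF//; lra.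
rewrite -(ler_pM2l l0) mulrDr (mulrCA l s) divff ?gt_eqF//; lra.
Qed.

Lemma square_deviation n (l s : R) : 0 < l <= 4^-1 ->
  exists B : set T, [/\ measurable B, (P B <= (2 * expR (- s))%:E)%E &
    forall t, ~ B t -> `|\sum_(j < n) (X (kappa j) t ^+ 2 - 1)| <= 4 * l * n%:R + s / l].
Proof.
move=> /andP[l0 l4].
pose f (c : R) (j : nat) (t : T) (x : R) := c * (x ^+ 2 - 1) - 4 * c ^+ 2.
have mf c j : measurable_fun setT
    (fun z : past (I j) * measurableTypeR R => f c j z.1 z.2).
  apply: measurable_funB => //; apply: measurable_funM => //.
  by apply: measurable_funB => //; exact: measurable_funX.
have f1 c j t : `|c| <= 4^-1 -> (\int[normal_prob 0 1]_x (expR (f c j t x))%:E <= 1)%E.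
  exact: normal_mgf_sqr.
have [|B1 [mB1 PB1 hB1]] := exponential_bound (mf l) (fun j t => f1 l j t _) n s.
  by rewrite gtr0_norm.
have [|B2 [mB2 PB2 hB2]] := exponential_bound (mf (- l)) (fun j t => f1 (- l) j t _) n s.
  by rewrite normrN gtr0_norm.
exists (B1 `|` B2); split; first exact: measurableU.
  rewrite (le_trans (measureU2 _ _ _))// mulr2n mulrDl mul1r EFinD.
  by rewrite leeD.
move=> t /not_orP[/hB1 + /hB2].
have fE c : \sum_(j < n) f c j t (X (kappa j) t) =
    c * (\sum_(j < n) (X (kappa j) t ^+ 2 - 1)) - 4 * c ^+ 2 * n%:R.
  by rewrite /f sumrB -mulr_sumr sumr_const card_ord mulr_natr.
rewrite !fE; set M := \sum_(j < n) _ => h1 h2.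
rewrite ler_norml; apply/andP; split.
  rewrite lerNl -(ler_pM2l l0) mulrDr (mulrCA l s) divff ?gt_eqF//; lra.
rewrite -(ler_pM2l l0) mulrDr (mulrCA l s) divff ?gt_eqF//; lra.
Qed.

End supermartingale.

End freezing.

(** * Linear forms with independent random coefficients *)

Section mixture.
Context d (T : measurableType d) (R : realType) (P : probability T R).
Variables (K : choiceType) (X : K -> {RV P >-> R}).
Hypothesis indX : mutually_independent P X.
Variables (kappa : nat -> K) (I : nat -> set K).
Hypothesis I_fresh : forall j, ~ I j (kappa j).
Hypothesis I_mono : forall j, I j `<=` I j.+1.
Hypothesis I_next : forall j, I j.+1 (kappa j).
Hypothesis law : forall j, has_law P (X (kappa j)) (normal_prob 0 1).
Variables (a : nat -> T -> R) (b : T -> R) (n : nat).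
Hypothesis ma : forall j, measurable_fun setT (a j : past X (I 0) -> R).
Hypothesis mb : measurable_fun setT (b : past X (I 0) -> R).

Let W m t := \sum_(j < m) a j t * X (kappa j) t.
Let r m t := Num.sqrt (\sum_(m <= j < n) a j t ^+ 2).

Let mid m : measurable_fun setT (idfun : past X (I m) -> past X (I 0)).
Proof.
apply: past_subset; elim: m => // m IH.
exact: (subset_trans IH).
Qed.

Let mW m : measurable_fun setT (W m : past X (I m) -> R).
Proof.
elim: m => [|m IH].
  by rewrite (_ : W 0 = cst 0)//; apply/funext => t; rewrite /W big_ord0.
rewrite (_ : W m.+1 = fun t => W m t + a m t * X (kappa m) t); last first.
  by apply/funext => t; rewrite /W big_ord_recr.
apply: measurable_funD.
  exact: measurableT_comp IH (past_subset (@I_mono m)).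
apply: measurable_funM; first exact: measurableT_comp (@ma m) (@mid m.+1).
exact: measurable_past.
Qed.

Let mr m k : measurable_fun setT (r k : past X (I m) -> R).
Proof.
have msqrt : measurable_fun setT (@Num.sqrt R).
  by apply: continuous_measurable_fun; exact: sqrt_continuous.
apply: (measurableT_comp msqrt); apply: measurable_sum => j.
apply: measurable_funX; exact: measurableT_comp (@ma j) (@mid m).
Qed.

Let G m := (\int[P]_t normal_prob 0 1 [set u | (W m t + r m t * u <= b t)%R])%E.

Let G_step m : (m < n)%N -> G m.+1 = G m.
Proof.
move=> mn.
pose TX : measurableType _ := past X (I m).
pose A : set ((TX * measurableTypeR R) * measurableTypeR R) :=
  [set z | W m z.1.1 + a m z.1.1 * z.1.2 + r m.+1 z.1.1 * z.2 <= b z.1.1].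
have mfst2 : measurable_fun setT (fun z : (TX * measurableTypeR R) * measurableTypeR R => z.1.1).
  exact: (measurableT_comp measurable_fst measurable_fst).
have mA : measurable A.
  rewrite -[X in measurable X]setTI; apply: measurable_fun_le => //.
    apply: measurable_funD; last first.
      apply: measurable_funM; last exact: measurable_snd.
      exact: (measurableT_comp (@mr m m.+1) mfst2).
    apply: measurable_funD; first exact: (measurableT_comp (@mW m) mfst2).
    apply: measurable_funM; last exact: (measurableT_comp measurable_snd measurable_fst).
    exact: (measurableT_comp (measurableT_comp (@ma m) (@mid m)) mfst2).
  exact: (measurableT_comp (measurableT_comp mb (@mid m)) mfst2).
pose F (z : TX * measurableTypeR R) := normal_prob 0 1
  [set u | W m z.1 + a m z.1 * z.2 + r m.+1 z.1 * u <= b z.1].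
have FE : F = fubini_F (normal_prob 0 1) (EFin \o \1_A).
  apply/funext => z; rewrite /fubini_F/=.
  have mAz : measurable [set u : measurableTypeR R | A (z, u)].
    by have := measurable_xsection z mA; rewrite xsectionE.
  transitivity (normal_prob 0 1 ([set u | A (z, u)] `&` setT)); first by rewrite setIT.
  by rewrite -(integral_indic (normal_prob 0 1)).
have mF : measurable_fun setT F.
  rewrite FE; apply: measurable_fun_fubini_tonelli_F.
    by apply/measurable_EFinP; exact: measurable_indic.
  by move=> z; rewrite lee_fin indicE ler0n.
have F0 z : (0 <= F z)%E by exact: measure_ge0.
rewrite /G (eq_integral (fun t => F (t, X (kappa m) t))); last first.
  move=> t _; rewrite /F/= /W big_ord_recr//=.
rewrite (freezing indX (@I_fresh m) (law m) mF F0).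
apply: eq_integral => t _; rewrite /F/=.
rewrite normal_prob_convolution ?sqrtr_ge0//.
congr (normal_prob _ _ _); apply/seteqP.
have -> : r m t = Num.sqrt (r m.+1 t ^+ 2 + a m t ^+ 2).
  rewrite /r sqr_sqrtr; last by apply: sumr_ge0 => j _; exact: sqr_ge0.
  by rewrite [in LHS]big_ltn// addrC.
by split.
Qed.

(** Given [past X (I 0)] the sum is centred normal with variance [\sum a_j^2].
The proof replaces the innovations from [m] on by a single normal variable [u]
of the same total variance; by [normal_prob_convolution] the resulting
probability [G m] does not depend on [m]. It is the right-hand side for [m = 0]
and the left-hand side for [m = n]. *)
Lemma gaussian_mixture :
  P [set t | \sum_(j < n) a j t * X (kappa j) t <= b t] =
  (\int[P]_t normal_prob 0 1 [set u | (Num.sqrt (\sum_(j < n) a j t ^+ 2) * u <= b t)%R])%E.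
Proof.
have GE m : (m <= n)%N -> G m = G 0.
  elim: m => [//|m IH mn]; exact: (etrans (G_step mn) (IH (ltnW mn))).
transitivity (G n); last first.
  rewrite (GE n (leqnn n)); apply: eq_integral => t _.
  by rewrite /W /r big_ord0 big_mkord; under eq_set do rewrite add0r.
have mE : measurable [set t | W n t <= b t].
  rewrite -[X in measurable X]setTI; apply: measurable_fun_le => //.
    exact: past_fun (@mW n).
  exact: past_fun mb.
transitivity (P ([set t | W n t <= b t] `&` setT)); first by rewrite setIT.
rewrite -integral_indic//.
apply: eq_integral => t _; rewrite indicE /r big_geq// sqrtr0.
have [h|h] := boolP (W n t <= b t).
  rewrite mem_set// [X in normal_prob _ _ X](_ : _ = setT).
    by rewrite (@probability_setT _ _ _ (normal_prob 0 1)).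
  by apply/seteqP; split=> u //= _; rewrite mul0r addr0.
rewrite memNset/=; last exact/negP.
rewrite [X in normal_prob _ _ X](_ : _ = set0) ?measure0//.
by apply/seteqP; split=> u //=; rewrite mul0r addr0 (negbTE h).
Qed.

End mixture.

(** * Algebra of the autoregressive recursion *)

Section ar1_algebra.
Variable R : realType.
Variable alpha : R.
Implicit Types (e u : nat -> R) (n k : nat).
Notation beta := (1 - alpha ^+ 2).

(** Square the recursion and sum: [\sum x_(i+1)^2] reappears on the right with
the factor [alpha ^+ 2], up to the boundary term. *)
Lemma ar1_sum_sqr e n : let x := ar1 alpha e in
  beta * \sum_(i < n) x i.+1 ^+ 2 =
  \sum_(i < n) e i ^+ 2 + 2 * alpha * \sum_(i < n) x i * e i - alpha ^+ 2 * x n ^+ 2.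
Proof.
move=> x; elim: n => [|n IH]; first by rewrite !big_ord0 /x /=; ring.
rewrite !big_ord_recr/= mulrDr IH (_ : x n.+1 = alpha * x n + e n)//; ring.
Qed.

Lemma ar1_sum e n : let x := ar1 alpha e in
  (1 - alpha) * \sum_(i < n) x i.+1 = \sum_(i < n) e i - alpha * x n.
Proof.
move=> x; elim: n => [|n IH]; first by rewrite !big_ord0 /x /=; ring.
rewrite !big_ord_recr/= mulrDr IH (_ : x n.+1 = alpha * x n + e n)//; ring.
Qed.

(** Here [v] is the recursion driven by [x]. Substituting both recursions in
[x_(i+1) * v_(i+1)] makes the cross sum reappear with the factor [alpha ^+ 2]. *)
Lemma ar1_sum_cross e n :
  let x := ar1 alpha e in let v := ar1 alpha (fun i => x i.+1) in
  beta * \sum_(i < n) x i.+1 * v i.+1 =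
  \sum_(i < n) x i.+1 ^+ 2 + alpha * \sum_(i < n) v i * e i - alpha ^+ 2 * (x n * v n).
Proof.
move=> x v; elim: n => [|n IH]; first by rewrite !big_ord0 /x /v /=; ring.
rewrite !big_ord_recr/= mulrDr IH (_ : v n.+1 = alpha * v n + x n.+1)//.
rewrite mulrDr (_ : x n.+1 = alpha * x n + e n)//; ring.
Qed.

(** The recursion run backwards from time [n], that is, the transpose of the
linear map [e |-> ar1 alpha e]; see [ar1_duality]. *)
Definition ar1_adjoint u n k : R := \sum_(k <= i < n) alpha ^+ (i - k) * u i.

Lemma ar1_adjoint_rec u n k : (k < n)%N ->
  ar1_adjoint u n k = u k + alpha * ar1_adjoint u n k.+1.
Proof.
move=> kn; rewrite /ar1_adjoint big_ltn// subnn mul1r mulr_sumr; congr (_ + _).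
rewrite big_nat [RHS]big_nat; apply: eq_bigr => i /andP[ki _].
by rewrite mulrA -exprS -subnSK.
Qed.

Lemma ar1_adjoint_end u n : ar1_adjoint u n n = 0.
Proof. by rewrite /ar1_adjoint big_geq. Qed.

Lemma ar1_adjoint_sub u n k c :
  ar1_adjoint (fun i => u i - c) n k = ar1_adjoint u n k - c * ar1_adjoint (fun=> 1) n k.
Proof.
rewrite /ar1_adjoint mulr_sumr -sumrB; apply: eq_bigr => i _; ring.
Qed.

(** Summation by parts; stopped at an intermediate time [m], the two sums differ
by [alpha * ar1_adjoint u n m * ar1 alpha e m], which vanishes at both ends. *)
Lemma ar1_duality e u n :
  \sum_(j < n) u j * ar1 alpha e j.+1 = \sum_(k < n) ar1_adjoint u n k * e k.
Proof.
set x := ar1 alpha e; set A := ar1_adjoint u n.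
have H m : (m <= n)%N ->
    \sum_(k < m) A k * e k = \sum_(j < m) u j * x j.+1 + alpha * A m * x m.
  elim: m => [_|m IH mn]; first by rewrite !big_ord0 /x/=; ring.
  rewrite !big_ord_recr/= IH ?(ltnW mn)// (_ : x m.+1 = alpha * x m + e m)//.
  by rewrite (_ : A m = u m + alpha * A m.+1); [ring|exact: ar1_adjoint_rec].
by rewrite H// /A ar1_adjoint_end; ring.
Qed.

(** Squaring the backward recursion leaves the sum of [ar1_adjoint u n k * u k],
which duality turns into a forward sum. For [u] the path itself that sum is
covered by [ar1_sum_cross]. *)
Lemma ar1_adjoint_sum_sqr u n :
  beta * \sum_(k < n) ar1_adjoint u n k ^+ 2 =
  2 * \sum_(j < n) u j * ar1 alpha u j.+1 - \sum_(j < n) u j ^+ 2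
  - alpha ^+ 2 * ar1_adjoint u n 0 ^+ 2.
Proof.
rewrite ar1_duality; set A := ar1_adjoint u n.
have H m : (m <= n)%N -> beta * \sum_(k < m) A k ^+ 2 =
    2 * \sum_(k < m) A k * u k - \sum_(k < m) u k ^+ 2
    - alpha ^+ 2 * A 0 ^+ 2 + alpha ^+ 2 * A m ^+ 2.
  elim: m => [_|m IH mn]; first by rewrite !big_ord0; ring.
  rewrite !big_ord_recr/= mulrDr IH ?(ltnW mn)//.
  by rewrite (_ : A m = u m + alpha * A m.+1); [ring|exact: ar1_adjoint_rec].
by rewrite H// /A ar1_adjoint_end; ring.
Qed.

Section stable.
Hypothesis alpha_lt1 : `|alpha| < 1.
Notation gamma := (1 - `|alpha|).

Let gamma_gt0 : 0 < gamma. Proof. by rewrite subr_gt0. Qed.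

Let contract (M y z : R) : `|y| <= M / gamma -> `|z| <= M -> `|alpha * y + z| <= M / gamma.
Proof.
move=> hy hz; rewrite (le_trans (ler_normD _ _))// normrM.
have -> : M / gamma = `|alpha| * (M / gamma) + M by field; rewrite gt_eqF.
by rewrite lerD// ler_wpM2l.
Qed.

Lemma ar1_bound e n M : 0 <= M -> (forall i, (i < n)%N -> `|e i| <= M) ->
  forall k, (k <= n)%N -> `|ar1 alpha e k| <= M / gamma.
Proof.
move=> M0 he; elim=> [_|k IH kn] /=.
  by rewrite normr0 divr_ge0// ltW.
by apply: contract; [exact: IH (ltnW kn)|exact: he].
Qed.

Lemma ar1_adjoint_bound u n M : 0 <= M -> (forall i, (i < n)%N -> `|u i| <= M) ->
  forall k, `|ar1_adjoint u n k| <= M / gamma.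
Proof.
move=> M0 hu k.
have [nk|kn] := leqP n k.
  by rewrite /ar1_adjoint big_geq// normr0 divr_ge0// ltW.
rewrite -(subKn (ltnW kn)); elim: (n - k)%N (leq_subr k n) => [_|j IH jn].
  by rewrite subn0 ar1_adjoint_end normr0 divr_ge0// ltW.
have lt : (n - j.+1 < n)%N by rewrite -subn_gt0 subKn.
rewrite ar1_adjoint_rec// addrC; apply: contract; last exact: hu.
by rewrite subnSK//; exact: IH (ltnW jn).
Qed.

(** By convexity [(alpha * x + e) ^+ 2 <= `|alpha| * x ^+ 2 + e ^+ 2 / gamma], and
summing this contraction bounds the square sum of [x]. *)
Lemma ar1_sum_sqr_le e n :
  \sum_(i < n) ar1 alpha e i.+1 ^+ 2 <= (\sum_(i < n) e i ^+ 2) / gamma ^+ 2.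
Proof.
set x := ar1 alpha e; set S := \sum_(i < n) x i.+1 ^+ 2.
have shift : \sum_(i < n) x i ^+ 2 <= S.
  have e1 : \sum_(i < n.+1) x i ^+ 2 = \sum_(i < n) x i ^+ 2 + x n ^+ 2.
    by rewrite big_ord_recr.
  have : \sum_(i < n.+1) x i ^+ 2 = S by rewrite big_ord_recl/= expr0n add0r.
  by rewrite e1 => <-; rewrite lerDl sqr_ge0.
have conv i : x i.+1 ^+ 2 <= `|alpha| * x i ^+ 2 + e i ^+ 2 / gamma.
  rewrite -subr_ge0 (_ : x i.+1 = alpha * x i + e i)//.
  have : alpha ^+ 2 = `|alpha| ^+ 2 by rewrite real_normK ?num_real.
  have := ler_norm (- alpha); rewrite normrN; move: (ler_norm alpha) gamma_gt0.
  set p := `|alpha|; set w := x i; set z := e i => ap g0 pa a2.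
  (* a combination of squares, with nonnegative weights since p = `|alpha| *)
  have -> : p * w ^+ 2 + z ^+ 2 / (1 - p) - (alpha * w + z) ^+ 2 =
    ((p + alpha) * ((1 - p) * w - z) ^+ 2 + (p - alpha) * ((1 - p) * w + z) ^+ 2)
    / (2 * (1 - p)) + (p ^+ 2 - alpha ^+ 2) * w ^+ 2.
    by field; rewrite gt_eqF.
  rewrite a2 subrr mul0r addr0 divr_ge0 ?mulr_ge0 ?(ltW g0)// addr_ge0// mulr_ge0 ?sqr_ge0//; lra.
have : S <= `|alpha| * S + (\sum_(i < n) e i ^+ 2) / gamma.
  apply: (@le_trans _ _ (\sum_(i < n) (`|alpha| * x i ^+ 2 + e i ^+ 2 / gamma))).
    by apply: ler_sum => i _; exact: conv.
  by rewrite big_split/= -mulr_sumr -mulr_suml lerD2r ler_wpM2l.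
rewrite exprS invfM mulrA ler_pdivlMr// => h.
by rewrite mulrBr mulr1 lerBlDl mulrC.
Qed.

End stable.
End ar1_algebra.

(** * Quadratic statistics along a good noise path *)

Section good_noise.
Variable R : realType.
Variable alpha : R.
Hypothesis alpha_lt1 : `|alpha| < 1.
Notation beta := (1 - alpha ^+ 2).
Notation gamma := (1 - `|alpha|).

(** What is asked of a noise path. All five conditions hold with high probability
(see [good_noise_probability]), and everything else in this part follows from
them by deterministic estimates. *)
Record good_noise (n : nat) (eps : R) (e : nat -> R) : Prop := GoodNoise {
  good_ar : `|\sum_(i < n) ar1 alpha e i * e i| <=
    eps / 2 * (\sum_(i < n) ar1 alpha e i ^+ 2) + 2 * n%:R * eps;
  good_ar2 : let v := ar1 alpha (fun i => ar1 alpha e i.+1) in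
    `|\sum_(i < n) v i * e i| <= eps / 2 * (\sum_(i < n) v i ^+ 2) + 2 * n%:R * eps;
  good_sqr : `|\sum_(i < n) (e i ^+ 2 - 1)| <= 6 * n%:R * eps;
  good_sum : `|\sum_(i < n) e i| <= 3 * n%:R * eps;
  good_max : forall i, (i < n)%N -> `|e i| <= 3 * (Num.sqrt n%:R * eps) }.

(** The weight of the [k]-th innovation of the second path in the centred cross
sum; see [emp_cov_weights]. *)
Definition centered_weight n (x : nat -> R) k :=
  ar1_adjoint alpha (fun i => x i.+1 - n%:R^-1 * \sum_(j < n) x j.+1) n k.

Let beta_gt0 : 0 < beta.
Proof. by rewrite subr_gt0 -(real_normK (num_real alpha)) expr_lt1. Qed.
Let gamma_gt0 : 0 < gamma. Proof. by rewrite subr_gt0. Qed.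

Lemma sum_sqr_shift (x : nat -> R) n : x 0 = 0 ->
  \sum_(i < n) x i ^+ 2 <= \sum_(i < n) x i.+1 ^+ 2.
Proof.
move=> x0; have e1 : \sum_(i < n.+1) x i ^+ 2 = \sum_(i < n) x i ^+ 2 + x n ^+ 2.
  by rewrite big_ord_recr.
have : \sum_(i < n.+1) x i ^+ 2 = \sum_(i < n) x i.+1 ^+ 2.
  by rewrite big_ord_recl/= x0 expr0n add0r.
by rewrite e1 => <-; rewrite lerDl sqr_ge0.
Qed.

Lemma emp_cov_sqrE n (x : nat -> R) : emp_cov n x x =
  n%:R^-1 * \sum_(i < n) x i.+1 ^+ 2 - (n%:R^-1 * \sum_(i < n) x i.+1) ^+ 2.
Proof.
by rewrite /emp_cov !big_add1/= !big_mkord exprMn exprVn expr2.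
Qed.

(* Constants of the successive estimates: c1 for the square sum, c2 for the mean,
   c3 for the cross sum, c4 for the uncentred weights, c5 for the centring. *)
Let c1 := 10 + 22 / beta + 9 / gamma ^+ 2.
Let c2 := (3 + 3 / gamma) / gamma.
Let c3 := 11 / beta / gamma ^+ 2 + 2 + 9 / gamma ^+ 3.
Let c4 := 2 * c3 + 2 * c1 + 9 / gamma ^+ 4.
Let c5 := c2 * ((2 + c4) / beta ^+ 3 + (gamma ^+ 2)^-1) + c2 ^+ 2 / gamma ^+ 2.
Let c6 := c1 + c2 ^+ 2 + (c4 + c5).

Let beta_le1 : beta <= 1. Proof. by rewrite gerBl sqr_ge0. Qed.
Let c1_ge0 : 0 <= c1.
Proof.
rewrite /c1; move: (gamma) (beta) (ltW gamma_gt0) (ltW beta_gt0) => g b g0 b0.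
by rewrite !(addr_ge0, divr_ge0, exprn_ge0).
Qed.
Let c2_ge0 : 0 <= c2.
Proof.
rewrite /c2; move: (gamma) (ltW gamma_gt0) => g g0.
by rewrite !(addr_ge0, divr_ge0, exprn_ge0).
Qed.
Let c3_ge0 : 0 <= c3.
Proof.
rewrite /c3; move: (gamma) (beta) (ltW gamma_gt0) (ltW beta_gt0) => g b g0 b0.
by rewrite !(addr_ge0, divr_ge0, exprn_ge0).
Qed.
Let c4_ge0 : 0 <= c4.
Proof.
rewrite /c4; move: (gamma) (c1) (c3) (ltW gamma_gt0) c1_ge0 c3_ge0 => y c c' y0 h h'.
by rewrite !(addr_ge0, divr_ge0, exprn_ge0, mulr_ge0).
Qed.
Let c5_ge0 : 0 <= c5.
Proof.
rewrite /c5; move: (gamma) (beta) (c2) (c4) (ltW gamma_gt0) (ltW beta_gt0) c2_ge0 c4_ge0.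
by move=> y b c c' y0 b0 h h'; rewrite !(addr_ge0, mulr_ge0, invr_ge0, exprn_ge0).
Qed.
Let c6_ge0 : 0 <= c6.
Proof.
by apply: addr_ge0; apply: addr_ge0 => //; exact: sqr_ge0.
Qed.

Section bounds.
Variables (n : nat) (eps : R) (e : nat -> R).
Hypothesis n_gt0 : (0 < n)%N.
Hypothesis eps_gt0 : 0 < eps.
Hypothesis eps_le1 : eps <= 1.
Hypothesis eps_beta : eps <= beta / 2.
Hypothesis good : good_noise n eps e.
Let x := ar1 alpha e.
Let v := ar1 alpha (fun i => x i.+1).
Let N : R := n%:R.
Let S := \sum_(i < n) x i.+1 ^+ 2.

Let N_ge1 : 1 <= N. Proof. by rewrite ler1n. Qed.
Let Neps_ge0 : 0 <= N * eps. Proof. by rewrite mulr_ge0 ?ler0n// ltW. Qed.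
Let S_ge0 : 0 <= S. Proof. by apply: sumr_ge0 => i _; exact: sqr_ge0. Qed.

Let alphaM y : `|alpha * y| <= `|y|.
Proof. by rewrite normrM ler_piMl// ltW. Qed.

(* A bound for the innovations, and up to powers of gamma for all boundary terms;
   its square is of order N * eps. *)
Let mu1 := 3 * (Num.sqrt N * eps).
Let mu1_ge0 : 0 <= mu1. Proof. by rewrite !mulr_ge0// ltW. Qed.
Let mu1_sqr : mu1 ^+ 2 <= 9 * (N * eps).
Proof.
rewrite /mu1 !exprMn sqr_sqrtr ?ler0n// expr2 (expr2 eps).
have : N * (eps * eps) <= N * eps by rewrite ler_wpM2l ?ler0n// ler_piMl// ltW.
lra.
Qed.
Let mu1_le : mu1 <= 3 * (N * eps).
Proof.
rewrite ler_wpM2l// ler_wpM2r ?(ltW eps_gt0)//.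
rewrite -[leRHS](@sqr_sqrtr _ N) ?ler0n// expr2 ler_peMl ?sqrtr_ge0//.
by rewrite -[leLHS]sqrtr1 ler_wsqrtr.
Qed.

Let x_bound k : (k <= n)%N -> `|x k| <= mu1 / gamma.
Proof. by apply: ar1_bound => //; exact: good_max. Qed.

Let v_bound k : (k <= n)%N -> `|v k| <= mu1 / gamma / gamma.
Proof.
apply: ar1_bound => // [|i lti]; first by rewrite divr_ge0// ltW.
exact: x_bound.
Qed.

Let adjoint_bound : `|ar1_adjoint alpha (fun i => x i.+1) n 0| <= mu1 / gamma / gamma.
Proof.
apply: ar1_adjoint_bound => // [|i lti]; first by rewrite divr_ge0// ltW.
exact: x_bound.
Qed.

(** Up to a multiple of [N] the martingale term contributes at most
[eps * S <= beta / 2 * S], which is absorbed in the left-hand side [beta * S]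
of [ar1_sum_sqr]. *)
Lemma sum_sqr_le : S <= 22 / beta * N.
Proof.
have hM := good_ar good; have hE := good_sqr good.
have hs : \sum_(i < n) x i ^+ 2 <= S by exact: sum_sqr_shift.
have : beta * S = \sum_(i < n) e i ^+ 2 + 2 * alpha * \sum_(i < n) x i * e i
  - alpha ^+ 2 * x n ^+ 2 by exact: ar1_sum_sqr.
move: hM hE; rewrite sumrB sumr_const card_ord -/N -/x.
set M := \sum_(i < n) x i * e i; set E2 := \sum_(i < n) e i ^+ 2.
move=> hM /ler_normlP[_ hE] eq.
have : eps * \sum_(i < n) x i ^+ 2 <= eps * S by rewrite ler_wpM2l// ltW.
have : eps * S <= beta / 2 * S by rewrite ler_wpM2r.
have := le_trans (ler_norm _) (alphaM M).
have : 0 <= alpha ^+ 2 * x n ^+ 2 by rewrite mulr_ge0 ?sqr_ge0.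
have : N * eps <= N by rewrite ler_piMr ?ler0n.
move=> h1 h2 h3 h4 h5.
have : beta * S <= 22 * N by lra.
by rewrite -ler_pdivlMl// mulrA [beta^-1 * _]mulrC.
Qed.

Lemma sum_sqr_limit : `|beta * S - N| <= c1 * (N * eps).
Proof.
have hM := good_ar good; have hE := good_sqr good.
have hs : \sum_(i < n) x i ^+ 2 <= S by exact: sum_sqr_shift.
rewrite /S (ar1_sum_sqr alpha e n) -/x.
move: hM hE; rewrite sumrB sumr_const card_ord -/N -/x.
set M := \sum_(i < n) x i * e i; set E2 := \sum_(i < n) e i ^+ 2.
move=> hM hE.
have h1 : eps * \sum_(i < n) x i ^+ 2 <= 22 / beta * (N * eps).
  by rewrite mulrA [leRHS]mulrC ler_wpM2l ?(ltW eps_gt0)// (le_trans hs)// sum_sqr_le.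
have h2 : `|alpha ^+ 2 * x n ^+ 2| <= 9 / gamma ^+ 2 * (N * eps).
  rewrite -exprMn normrX (@le_trans _ _ ((mu1 / gamma) ^+ 2))//.
    by rewrite ler_pXn2r ?nnegrE ?divr_ge0 ?(ltW gamma_gt0)// (le_trans (alphaM _))// x_bound.
  by rewrite exprMn exprVn [leRHS]mulrAC ler_wpM2r// invr_ge0 sqr_ge0.
have h3 := alphaM M.
have -> : E2 + 2 * alpha * M - alpha ^+ 2 * x n ^+ 2 - N =
  (E2 - N) + 2 * (alpha * M) - alpha ^+ 2 * x n ^+ 2 by ring.
rewrite (le_trans (ler_normB _ _))// (le_trans (lerD (ler_normD _ _) (lexx _)))//.
rewrite normrM (ger0_norm (ler0n _ 2)) /c1.
lra.
Qed.

Lemma mean_limit : `|N^-1 * \sum_(i < n) x i.+1| <= c2 * eps.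
Proof.
have hs := good_sum good.
rewrite normrM ger0_norm ?invr_ge0 ?ler0n// ler_pdivrMl ?(lt_le_trans _ N_ge1)//.
rewrite mulrCA /c2 -[leRHS]mulrAC ler_pdivlMr//.
rewrite (@le_trans _ _ (`|(1 - alpha) * \sum_(i < n) x i.+1|))//.
  rewrite normrM mulrC ler_wpM2r// (le_trans _ (ler_norm _))// lerD2l lerN2.
  exact: ler_norm.
rewrite ar1_sum -/x (le_trans (ler_normB _ _))//.
have h1 := alphaM (x n); have h2 := x_bound (leqnn n).
have h3 : mu1 / gamma <= 3 / gamma * (N * eps).
  by rewrite [leRHS]mulrAC ler_wpM2r// invr_ge0 ltW.
by move: hs; rewrite -/N; lra.
Qed.

Lemma sum_cross_limit :
  `|beta * (\sum_(i < n) x i.+1 * v i.+1) - S| <= c3 * (N * eps).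
Proof.
have hM := good_ar2 good; rewrite /= -/x -/v in hM.
rewrite (ar1_sum_cross alpha e n) -/x -/v -/S addrAC.
rewrite (_ : S + alpha * _ - S = alpha * \sum_(i < n) v i * e i); last by ring.
move: hM; set M := \sum_(i < n) v i * e i => hM.
have h1 : eps / 2 * \sum_(i < n) v i ^+ 2 <= 11 / beta / gamma ^+ 2 * (N * eps).
  rewrite (_ : _ / _ / _ * _ = eps / 2 * ((22 / beta * N) / gamma ^+ 2)); last first.
    by field; rewrite !gt_eqF.
  rewrite ler_wpM2l ?divr_ge0 ?(ltW eps_gt0)//.
  rewrite (le_trans (@sum_sqr_shift v n _))// (le_trans (ar1_sum_sqr_le alpha_lt1 _ n))//.
  by rewrite ler_wpM2r ?invr_ge0 ?sqr_ge0// sum_sqr_le.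
have h2 : `|alpha ^+ 2 * (x n * v n)| <= 9 / gamma ^+ 3 * (N * eps).
  rewrite expr2 -mulrA (le_trans (alphaM _))// (le_trans (alphaM _))// normrM.
  rewrite (@le_trans _ _ ((mu1 / gamma) * (mu1 / gamma / gamma)))//.
    by rewrite ler_pM// ?x_bound// v_bound.
  rewrite (_ : _ * _ = mu1 ^+ 2 / gamma ^+ 3); last by field; rewrite gt_eqF.
  by rewrite [leRHS]mulrAC ler_wpM2r// invr_ge0 exprn_ge0// ltW.
have h3 := alphaM M.
by rewrite (le_trans (ler_normB _ _))// /c3; move: hM; rewrite -/N; lra.
Qed.

Let A k := ar1_adjoint alpha (fun i => x i.+1) n k.
Let g k := ar1_adjoint alpha (fun=> 1) n k.
Let Q0 := \sum_(k < n) A k ^+ 2.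
(** [ar1_adjoint_sum_sqr] expresses [Q0] through the cross sum [D] and [S], and
[beta * D] is close to [S], itself close to [N / beta]; this gives
[beta ^+ 2 * Q0] close to [(2 / beta - 1) * N]. *)
Lemma adjoint_limit : `|beta ^+ 3 * Q0 - (1 + alpha ^+ 2) * N| <= c4 * (N * eps).
Proof.
have hD := sum_cross_limit; have hS := sum_sqr_limit.
have eq : beta * Q0 = 2 * (\sum_(i < n) x i.+1 * v i.+1) - S - alpha ^+ 2 * A 0 ^+ 2.
  exact: ar1_adjoint_sum_sqr.
have hA : `|alpha ^+ 2 * A 0 ^+ 2| <= 9 / gamma ^+ 4 * (N * eps).
  rewrite -exprMn normrX (@le_trans _ _ ((mu1 / gamma / gamma) ^+ 2))//.
    rewrite ler_pXn2r ?nnegrE//; first exact: le_trans (alphaM _) adjoint_bound.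
    by rewrite divr_ge0 ?(ltW gamma_gt0)// divr_ge0 ?(ltW gamma_gt0).
  rewrite (_ : _ ^+ 2 = mu1 ^+ 2 / gamma ^+ 4); last by field; rewrite gt_eqF.
  by rewrite [leRHS]mulrAC ler_wpM2r// invr_ge0 exprn_ge0// ltW.
move: hD hS eq; set D := \sum_(i < n) x i.+1 * v i.+1 => hD hS eq.
have -> : beta ^+ 3 * Q0 - (1 + alpha ^+ 2) * N =
    2 * beta * (beta * D - S) + (1 + alpha ^+ 2) * (beta * S - N)
    - beta ^+ 2 * (alpha ^+ 2 * A 0 ^+ 2).
  by rewrite (_ : beta ^+ 3 * Q0 = beta ^+ 2 * (beta * Q0)); [rewrite eq; ring|ring].
have a2 : alpha ^+ 2 <= 1 by rewrite -subr_ge0 ltW.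
rewrite (le_trans (ler_normB _ _))// (le_trans (lerD (ler_normD _ _) (lexx _)))//.
rewrite /c4 (mulrDl _ _ (N * eps)) (mulrDl _ _ (N * eps)) !lerD//.
- rewrite normrM -mulrA ler_pM// ger0_norm ?mulr_ge0 ?(ltW beta_gt0)//.
  by rewrite -[leRHS]mulr1 ler_wpM2l.
- rewrite normrM -mulrA ler_pM// ger0_norm ?addr_ge0 ?sqr_ge0//; lra.
- rewrite normrM (le_trans _ hA)// ler_piMl//.
  by rewrite ger0_norm ?sqr_ge0// expr_le1// ltW.
Qed.

(** Centring changes [A k] by [w * g k] with [w] the mean of the path, of order
[eps], and [g] bounded. The cross term is controlled by [Q0 + G2], of order
[N]. *)
Lemma centered_weight_limit :
  `|beta ^+ 3 * (\sum_(k < n) centered_weight n x k ^+ 2) - (1 + alpha ^+ 2) * N| <=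
  (c4 + c5) * (N * eps).
Proof.
set w := N^-1 * \sum_(i < n) x i.+1.
have hw : `|w| <= c2 * eps by exact: mean_limit.
set Q := \sum_(k < n) _ ^+ 2; set Ag := \sum_(k < n) A k * g k.
set G2 := \sum_(k < n) g k ^+ 2.
have QE : Q = Q0 - 2 * w * Ag + w ^+ 2 * G2.
  rewrite /Q /Q0 /Ag /G2 !mulr_sumr -sumrB -big_split/=; apply: eq_bigr => k _.
  by rewrite /centered_weight ar1_adjoint_sub -/w -/(A k) -/(g k); ring.
have b3 : 0 < beta ^+ 3 by rewrite exprn_gt0.
have hlim := adjoint_limit.
have a2 : alpha ^+ 2 <= 1 by rewrite -subr_ge0 ltW.
have hQ0 : Q0 <= (2 + c4) / beta ^+ 3 * N.
  rewrite mulrAC ler_pdivlMr// mulrC.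
  have : (1 + alpha ^+ 2) * N <= 2 * N by rewrite ler_wpM2r ?ler0n//; lra.
  have : c4 * (N * eps) <= c4 * N by rewrite ler_wpM2l// ler_piMr ?ler0n.
  have := le_trans (ler_norm _) hlim; lra.
have hG2 : G2 <= (gamma ^+ 2)^-1 * N.
  rewrite mulr_natr -[n in leRHS]card_ord -sumr_const; apply: ler_sum => k _.
  rewrite -exprVn -(real_normK (num_real (g k))) ler_pXn2r ?nnegrE ?invr_ge0 ?(ltW gamma_gt0)//.
  by rewrite -[leRHS]mul1r; apply: ar1_adjoint_bound => // i _; rewrite normr1.
have G2_ge0 : 0 <= G2 by apply: sumr_ge0 => k _; exact: sqr_ge0.
have hAg : `|2 * Ag| <= Q0 + G2.
  rewrite /Ag mulr_sumr (le_trans (ler_norm_sum _ _ _))//.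
  rewrite /Q0 /G2 -big_split/=; apply: ler_sum => k _.
  rewrite ler_norml; apply/andP; split; rewrite -subr_ge0.
    by rewrite (_ : _ - _ = (A k + g k) ^+ 2) ?sqr_ge0//; ring.
  by rewrite (_ : _ - _ = (A k - g k) ^+ 2) ?sqr_ge0//; ring.
have -> : beta ^+ 3 * Q - (1 + alpha ^+ 2) * N =
    (beta ^+ 3 * Q0 - (1 + alpha ^+ 2) * N) + beta ^+ 3 * (w ^+ 2 * G2 - w * (2 * Ag)).
  by rewrite QE; ring.
rewrite (le_trans (ler_normD _ _))// (mulrDl _ _ (N * eps)) lerD//.
rewrite normrM (ger0_norm (ltW b3)).
rewrite (@le_trans _ _ (`|w ^+ 2 * G2 - w * (2 * Ag)|))//.
  by rewrite ler_piMl// expr_le1// ltW.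
rewrite (le_trans (ler_normB _ _))// addrC /c5 (mulrDl _ _ (N * eps)) lerD//.
  rewrite normrM (_ : _ * _ * (N * eps) =
    (c2 * eps) * ((2 + c4) / beta ^+ 3 * N + (gamma ^+ 2)^-1 * N)); last by ring.
  by rewrite ler_pM// (le_trans hAg)// lerD.
rewrite normrM normrX (ger0_norm G2_ge0).
rewrite (@le_trans _ _ ((c2 * eps) ^+ 2 * ((gamma ^+ 2)^-1 * N)))//.
  by rewrite ler_pM ?sqr_ge0// ler_pXn2r ?nnegrE// mulr_ge0// ltW.
have -> : (c2 * eps) ^+ 2 * ((gamma ^+ 2)^-1 * N) =
    (c2 ^+ 2 / gamma ^+ 2) * (N * (eps * eps)).
  by ring.
rewrite ler_wpM2l ?divr_ge0 ?exprn_ge0 ?(ltW gamma_gt0)//.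
by rewrite ler_wpM2l ?ler0n// ler_piMl// ltW.
Qed.

Lemma empirical_limits :
  `|beta * emp_cov n x x - 1| <= c6 * eps /\
  `|beta ^+ 3 * (n%:R^-1 * \sum_(k < n) centered_weight n x k ^+ 2) / (1 + alpha ^+ 2) - 1|
    <= c6 * eps.
Proof.
have N0 : 0 < N by rewrite ltr0n.
split.
  rewrite emp_cov_sqrE -/N -/S; set w := N^-1 * \sum_(i < n) x i.+1.
  have hw : `|w| <= c2 * eps by exact: mean_limit.
  have -> : beta * (N^-1 * S - w ^+ 2) - 1 = N^-1 * (beta * S - N) - beta * w ^+ 2.
    by field; rewrite gt_eqF.
  rewrite (le_trans (ler_normB _ _))//.
  have h1 : `|N^-1 * (beta * S - N)| <= c1 * eps.
    rewrite normrM ger0_norm ?invr_ge0 ?ler0n// ler_pdivrMl// mulrCA.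
    exact: sum_sqr_limit.
  have h2 : `|beta * w ^+ 2| <= c2 ^+ 2 * eps.
    rewrite normrM (ger0_norm (ltW beta_gt0)) (@le_trans _ _ `|w ^+ 2|)//.
      by rewrite ler_piMl.
    rewrite normrX (@le_trans _ _ ((c2 * eps) ^+ 2))//.
      by rewrite ler_pXn2r ?nnegrE// mulr_ge0// ltW.
    by rewrite exprMn ler_wpM2l ?sqr_ge0// expr2 ler_piMl// ltW.
  rewrite (le_trans (lerD h1 h2))// -mulrDl ler_wpM2r ?(ltW eps_gt0)//.
  by rewrite /c6 lerDl addr_ge0.
have a1 : 1 <= 1 + alpha ^+ 2 by rewrite lerDl sqr_ge0.
have a0 : 0 < 1 + alpha ^+ 2 by rewrite (lt_le_trans ltr01).
have := centered_weight_limit; set Q := \sum_(k < n) _ => hQ.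
have -> : beta ^+ 3 * (n%:R^-1 * Q) / (1 + alpha ^+ 2) - 1 =
   (N * (1 + alpha ^+ 2))^-1 * (beta ^+ 3 * Q - (1 + alpha ^+ 2) * N).
  by rewrite -/N; field; rewrite !gt_eqF.
rewrite normrM ger0_norm ?invr_ge0 ?mulr_ge0 ?ler0n ?(ltW a0)//.
rewrite ler_pdivrMl ?mulr_gt0// (le_trans hQ)//.
have -> : N * (1 + alpha ^+ 2) * (c6 * eps) = (1 + alpha ^+ 2) * (c6 * (N * eps)) by ring.
rewrite (@le_trans _ _ (c6 * (N * eps)))//.
  by rewrite ler_wpM2r// /c6 lerDr addr_ge0 ?sqr_ge0.
by rewrite ler_peMl// mulr_ge0.
Qed.

End bounds.

Lemma good_noise_limits : exists2 C : R, 0 <= C & forall (n : nat) (eps : R) (e : nat -> R),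
  (0 < n)%N -> 0 < eps -> eps <= 1 -> eps <= beta / 2 -> good_noise n eps e ->
  let x := ar1 alpha e in
  `|beta * emp_cov n x x - 1| <= C * eps /\
  `|beta ^+ 3 * (n%:R^-1 * \sum_(k < n) centered_weight n x k ^+ 2) / (1 + alpha ^+ 2) - 1|
    <= C * eps.
Proof.
by exists c6 => // n eps e *; exact: empirical_limits.
Qed.

End good_noise.

(** * Probability of a good noise path *)

Lemma measurable_ar1_lt d (T : measurableType d) (R : realType) (alpha : R)
    (e : nat -> T -> R) n : (forall i, (i < n)%N -> measurable_fun setT (e i)) ->
  measurable_fun setT (fun t => ar1 alpha (e ^~ t) n).
Proof.
elim: n => [_|n IH me] /=; first exact: measurable_cst.
apply: measurable_funD; last exact: me.
by apply: measurable_funM => //; apply: IH => i lti; apply: me; exact: ltnW.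
Qed.

(** Every deviation bound is used at level [s = 2 * ln n], so that each fails with
probability at most [2 / n ^+ 2] and a union over [n] innovations still costs
only [O(1 / n)]. *)
Section good_noise_probability.
Context d (T : measurableType d) (R : realType) (P : probability T R).
Variables (K : choiceType) (X : K -> {RV P >-> R}).
Hypothesis indX : mutually_independent P X.
Variable kappa : nat -> K.
Hypothesis kappa_inj : injective kappa.
Hypothesis law : forall j, has_law P (X (kappa j)) (normal_prob 0 1).
Variable alpha : R.
Variable n : nat.
Hypothesis n_ge2 : (1 < n)%N.
Let N : R := n%:R.
Let eps : R := Num.sqrt (ln N) / Num.sqrt N.
Hypothesis eps_le : eps <= 4^-1.

Let I (j : nat) : set K := [set kappa i | i in [set i | (i < j)%N]].

Let I_fresh j : ~ I j (kappa j).
Proof. by move=> [i /= ij /kappa_inj ij']; move: ij; rewrite ij' ltnn. Qed.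
Let I_mono j : I j `<=` I j.+1.
Proof. by move=> _ [i /= ij <-]; exists i => //=; exact: ltnW. Qed.
Let I_next j : I j.+1 (kappa j).
Proof. by exists j => /=. Qed.

Let N_gt0 : 0 < N. Proof. by rewrite ltr0n ltnW. Qed.
Let lnN_gt0 : 0 < ln N. Proof. by rewrite ln_gt0// ltr1n. Qed.
Let eps_gt0 : 0 < eps. Proof. by rewrite divr_gt0 ?sqrtr_gt0. Qed.
Let eps_sqr : ln N = N * eps ^+ 2.
Proof.
rewrite /eps expr_div_n !sqr_sqrtr ?ler0n ?(ltW lnN_gt0)//.
by rewrite mulrC divfK// gt_eqF.
Qed.
Let s : R := 2 * ln N.
Let s_eps : s / eps = 2 * N * eps.
Proof. by rewrite /s eps_sqr; field; rewrite gt_eqF. Qed.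
Let exp_s : expR (- s) = N ^- 2.
Proof. by rewrite expRN /s expRM_natl lnK// posrE. Qed.

Let me i j : (i < j)%N -> measurable_fun setT (X (kappa i) : past X (I j) -> R).
Proof. by move=> ij; apply: measurable_past; exists i. Qed.

Let mx j : measurable_fun setT
  ((fun t => ar1 alpha (fun i => X (kappa i) t) j) : past X (I j) -> R).
Proof. by apply: measurable_ar1_lt => i; exact: me. Qed.

Let mv j : measurable_fun setT
  ((fun t => ar1 alpha (fun i => ar1 alpha (fun i => X (kappa i) t) i.+1) j)
   : past X (I j) -> R).
Proof.
apply: (@measurable_ar1_lt _ (past X (I j)) _ _ (fun i t => ar1 alpha (fun i => X (kappa i) t) i.+1)).
by move=> i ij; apply: measurable_ar1_lt => k ki; apply: me; exact: leq_trans ij.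
Qed.

(** The bound on a single innovation is the linear one for a unit weight. The
parameter [Num.sqrt N * eps = Num.sqrt (ln N)] balances its two terms. *)
Let max_deviation m : exists B : set T,
  [/\ measurable B, (P B <= (m%:R * (2 * N ^- 2))%:E)%E &
   forall t, ~ B t -> forall i, (i < m)%N -> (i < n)%N ->
     `|X (kappa i) t| <= 3 * (Num.sqrt N * eps)].
Proof.
have sN : Num.sqrt N ^+ 2 = N by rewrite sqr_sqrtr// ler0n.
have sN0 : 0 < Num.sqrt N by rewrite sqrtr_gt0.
elim: m => [|m [B [mB PB hB]]].
  by exists set0; split => //; rewrite measure0 mul0r.
have l0 : 0 < Num.sqrt N * eps by rewrite mulr_gt0.
have [B' [mB' PB' hB']] := linear_deviation indX I_fresh I_mono I_next law
  (H := fun j _ => (j == m)%:R) n s l0 (fun j => @measurable_cst _ _ _ _ _ _).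
exists (B `|` B'); split; first exact: measurableU.
  rewrite (le_trans (measureU2 _ _ _))// -natr1 mulrDl mul1r EFinD leeD//.
  by rewrite (le_trans PB')// exp_s.
move=> t /not_orP[/hB hi /hB' hm] i; rewrite ltnS leq_eqVlt => /predU1P[->|im] lt_n; last exact: hi.
move: hm; rewrite (bigD1 (Ordinal lt_n))//= eqxx mul1r big1; last first.
  by move=> j /negbTE; rewrite -val_eqE/= => ->; rewrite mul0r.
rewrite addr0 (bigD1 (Ordinal lt_n))//= eqxx big1; last first.
  by move=> j /negbTE; rewrite -val_eqE/= => ->; rewrite expr0n.
rewrite expr1n addr0 mulr1 => /le_trans; apply.
have -> : s / (Num.sqrt N * eps) = 2 * (Num.sqrt N * eps).
  rewrite /s eps_sqr; move: sN sN0; set q := Num.sqrt N => sN q0.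
  by rewrite -sN; field; rewrite !gt_eqF.
lra.
Qed.

Lemma good_noise_probability : exists B : set T,
  [/\ measurable B, (P B <= (10 * N^-1)%:E)%E &
   forall t, ~ B t -> good_noise alpha n eps (fun j => X (kappa j) t)].
Proof.
have [B1 [m1 P1 h1]] := linear_deviation indX I_fresh I_mono I_next law n s eps_gt0 mx.
have [B2 [m2 P2 h2]] := linear_deviation indX I_fresh I_mono I_next law n s eps_gt0 mv.
have [|B3 [m3 P3 h3]] := @square_deviation _ _ _ _ _ _ indX _ _ I_fresh I_mono I_next law n eps s.
  by rewrite eps_gt0.
have [B4 [m4 P4 h4]] := linear_deviation indX I_fresh I_mono I_next law
  (H := fun _ _ => 1) n s eps_gt0 (fun j => @measurable_cst _ _ _ _ _ _).
have [B5 [m5 P5 h5]] := max_deviation n.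
exists (B1 `|` (B2 `|` (B3 `|` (B4 `|` B5)))); split.
- by do 4 (apply: measurableU => //).
- rewrite (@le_trans _ _ ((2 * expR (- s))%:E + ((2 * expR (- s))%:E +
    ((2 * expR (- s))%:E + ((2 * expR (- s))%:E + (n%:R * (2 * N ^- 2))%:E))))%E)//.
    do 4 (rewrite (le_trans (measureU2 _ _ _)) ?leeD//; try by do 4 (try apply: measurableU => //)).
  rewrite -!EFinD lee_fin exp_s -/N.
  have NV : N ^- 2 <= N^-1.
    have N1 : 1 <= N by rewrite ler1n ltnW.
    by rewrite lef_pV2 ?posrE ?exprn_gt0// expr2 ler_peMl// ltW.
  have -> : N * (2 * N ^- 2) = 2 * N^-1 by field; rewrite gt_eqF.
  lra.
move=> t /not_orP[/h1 {}h1 /not_orP[/h2 {}h2 /not_orP[/h3 {}h3 /not_orP[/h4 {}h4 /h5 {}h5]]]].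
split.
- by rewrite -s_eps.
- by rewrite -s_eps.
- by rewrite (le_trans h3)// s_eps; lra.
- move: h4; rewrite s_eps (eq_bigr (fun j : 'I_n => X (kappa j) t)); last by move=> j _; rewrite mul1r.
  have -> : \sum_(j < n) (1 : R) ^+ 2 = N.
    by under eq_bigr do rewrite expr1n; rewrite sumr_const card_ord.
  move=> /le_trans; apply.
  have := mulr_ge0 (ltW N_gt0) (ltW eps_gt0); lra.
- by move=> i lt_n; exact: h5.
Qed.

End good_noise_probability.

(** * Stability under random rescaling *)

Section perturbation.
Variable R : realType.

(** The thresholds are [z / (1 - delta)] and [z / (1 + delta)], in the order
dictated by the sign of [z]. *)
Lemma normal_cdf_sandwich (z delta : R) : 0 <= delta <= 2^-1 ->
  exists zlo zhi : R,
  [/\ normal_cdf z <= normal_cdf zlo + 2 * delta, normal_cdf zhi <= normal_cdf z + 2 * delta &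
   forall rho w : R, `|rho - 1| <= delta ->
     (rho * w <= z -> w <= zhi) /\ (w <= zlo -> rho * w <= z)].
Proof.
move=> /andP[d0 d1].
have m0 : 0 < 1 - delta by lra.
have p0 : 0 < 1 + delta by lra.
have tV : (1 - delta)^-1 - 1 <= 2 * delta.
  by rewrite lerBlDr -[leLHS]mul1r ler_pdivrMr//; nra.
have t1 : 1 <= (1 - delta)^-1 by rewrite invf_ge1//; lra.
have /ler_normlP[a1 a2] := normal_cdf_dilation z t1.
have t2 : 1 <= 1 + delta by lra.
have /ler_normlP[b1 b2] := normal_cdf_dilation (z / (1 + delta)) t2.
rewrite mulrCA divff ?gt_eqF// mulr1 in b1 b2.
rewrite (mulrC _ z) in a1 a2.
have rhoP rho : `|rho - 1| <= delta -> 1 - delta <= rho /\ rho <= 1 + delta.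
  by move=> /ler_normlP[]; lra.
have [z0|z0] := leP 0 z.
  exists (z / (1 + delta)), (z / (1 - delta)); split; [lra|lra|].
  move=> rho w /rhoP[r1 r2]; split=> h.
    rewrite ler_pdivlMr//; have [w0|w0] := leP 0 w; nra.
  move: h; rewrite ler_pdivlMr// => h; have [w0|w0] := leP 0 w; nra.
exists (z / (1 - delta)), (z / (1 + delta)); split; [lra|lra|].
move=> rho w /rhoP[r1 r2]; split=> h.
  rewrite ler_pdivlMr//; have [w0|w0] := leP 0 w; nra.
move: h; rewrite ler_pdivlMr// => h; have [w0|w0] := leP 0 w; nra.
Qed.

(** [`|Num.sqrt q - 1| <= `|q - 1|], since [q - 1] is the product of
[Num.sqrt q - 1] and [Num.sqrt q + 1]. *)
Lemma sqrt_ratio_bound (a b p h : R) : h <= 4^-1 ->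
  `|a - 1| <= h -> `|b - 1| <= h -> `|p - 1| <= h ->
  `|Num.sqrt (p / (a * b)) - 1| <= 8 * h.
Proof.
move=> h4 /ler_normlP[a1 a2] /ler_normlP[b1 b2] /ler_normlP[p1 p2].
have h0 : 0 <= h by lra.
have ab : 2^-1 <= a * b by nra.
have ab0 : 0 < a * b by rewrite (lt_le_trans _ ab).
have p0 : 0 <= p by lra.
set q := p / (a * b).
have q0 : 0 <= q by rewrite divr_ge0// ltW.
have hq : `|q - 1| <= 8 * h.
  have -> : q - 1 = (p - a * b) / (a * b) by rewrite /q; field; rewrite !gt_eqF//; lra.
  rewrite normrM normfV (gtr0_norm ab0) ler_pdivrMr//.
  rewrite ler_norml; apply/andP; split; nra.
apply: le_trans hq.
have -> : q - 1 = (Num.sqrt q - 1) * (Num.sqrt q + 1).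
  by rewrite -{1}(sqr_sqrtr q0); ring.
by rewrite normrM ler_peMr// ger0_norm ?addr_ge0 ?sqrtr_ge0// lerDr sqrtr_ge0.
Qed.

Lemma normal_tail_scale (s z : R) : 0 < s ->
  normal_prob 0 1 [set u | s * u <= z * s] = (normal_cdf z)%:E.
Proof.
move=> s0; rewrite normal_cdfE; congr (normal_prob _ _ _).
by apply/seteqP; split=> u /=; rewrite in_itv/= mulrC ler_pM2r.
Qed.

(** Off [B], the event [Theta t <= z] lies between two events of the form
[U t <= y * s t] with [y] close to [z]; by the mixture hypothesis each of these
has probability [normal_cdf y] up to [P B], because [U / s] is standard normal
as long as [s] is positive. *)
Lemma kolmogorov_perturbation d (T : measurableType d) (P : probability T R)
    (Theta U s : T -> R) (B : set T) (delta p z : R) :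
  measurable_fun setT Theta -> measurable_fun setT U -> measurable_fun setT s ->
  (forall y, P [set t | (U t <= y * s t)%R] =
    \int[P]_t normal_prob 0 1 [set u | (s t * u <= y * s t)%R])%E ->
  0 <= delta <= 2^-1 -> measurable B -> (P B <= p%:E)%E ->
  (forall t, ~ B t -> 0 < s t /\ exists2 rho, `|rho - 1| <= delta & Theta t = rho * (U t / s t)) ->
  (`|P [set t | (Theta t <= z)%R] - (normal_cdf z)%:E| <= (2 * delta + 2 * p)%:E)%E.
Proof.
move=> mT mU ms mix hd mB PB hB.
have [zlo [zhi [hlo hhi hw]]] := normal_cdf_sandwich z hd.
have mUy y : measurable [set t | U t <= y * s t].
  rewrite -[X in measurable X]setTI; apply: measurable_fun_le => //.
  exact: measurable_funM.
have mTh : measurable [set t | Theta t <= z].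
  by rewrite -[X in measurable X]setTI; exact: measurable_fun_le.
have PBf : P B \is a fin_num by exact: fin_num_measure.
have pB : fine (P B) <= p by rewrite -lee_fin fineK.
pose f y t := normal_prob 0 1 [set u | (s t * u <= y * s t)%R].
have mf y : measurable_fun setT (f y).
  pose A : set (T * measurableTypeR R) := [set w | s w.1 * w.2 <= y * s w.1].
  have mA : measurable A.
    have ms1 : measurable_fun setT (fun w : T * measurableTypeR R => s w.1).
      exact: (measurableT_comp ms measurable_fst).
    rewrite -[X in measurable X]setTI; apply: measurable_fun_le => //.
      exact: (measurable_funM ms1 measurable_snd).
    exact: measurable_funM.
  have -> : f y = normal_prob 0 1 \o xsection A.
    by apply/funext => t /=; rewrite xsectionE.
  exact: (measurable_fun_xsection (normal_prob 0 1) mA).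
have f0 y t : (0 <= f y t)%E by exact: measure_ge0.
have f1 y t : (f y t <= 1)%E.
  apply: (@probability_le1 _ _ _ (normal_prob 0 1)).
  rewrite -[X in measurable X]setTI; exact: measurable_fun_le.
have cdf0 (y : R) : 0 <= normal_cdf y by rewrite -lee_fin normal_cdfE.
have cdf1 (y : R) : ((normal_cdf y)%:E <= 1)%E.
  rewrite normal_cdfE; apply: (@probability_le1 _ _ _ (normal_prob 0 1)).
  by have : measurable (`]-oo, y]%classic : set (measurableTypeR R)) by exact: measurable_itv.
have mind : measurable_fun setT (fun t => (\1_B t)%:E : \bar R).
  by apply/measurable_EFinP; exact: measurable_indic.
have intB (c : R) : 0 <= c -> (\int[P]_t (c%:E + (\1_B t)%:E) = c%:E + P B)%E.
  move=> c0; rewrite ge0_integralD//.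
  by rewrite integral_cst// [X in (_ * X)%E]probability_setT mule1 integral_indic// setIT.
have up y : (P [set t | (U t <= y * s t)%R] <= (normal_cdf y + p)%:E)%E.
  rewrite mix (@le_trans _ _ (\int[P]_t ((normal_cdf y)%:E + (\1_B t)%:E))%E)//.
    apply: ge0_le_integral => //.
    - exact: mf.
    - by apply: emeasurable_funD => //; exact: measurable_cst.
    move=> t _; have [Bt|Bt] := pselect (B t).
      rewrite indicE mem_set//= (@le_trans _ _ 1%E)//; first exact: f1.
      by apply: leeDr; rewrite lee_fin.
    by rewrite indicE memNset//= adde0 normal_tail_scale//; have [] := hB t Bt.
  by rewrite intB// EFinD leeD2l.
have down y : ((normal_cdf y)%:E <= P [set t | (U t <= y * s t)%R] + p%:E)%E.
  rewrite mix (@le_trans _ _ (\int[P]_t (f y t + (\1_B t)%:E))%E)//.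
    rewrite -[leLHS](_ : \int[P]_t (cst (normal_cdf y)%:E t) = _)%E; last first.
      by rewrite integral_cst// [X in (_ * X)%E]probability_setT mule1.
    apply: ge0_le_integral => //.
    - by move=> t _ /=; rewrite lee_fin.
    - by apply: emeasurable_funD => //; exact: mf.
    move=> t _ /=; have [Bt|Bt] := pselect (B t).
      rewrite indicE mem_set//= (@le_trans _ _ 1%E)//.
      exact: leeDr.
    by rewrite indicE memNset//= adde0 /f normal_tail_scale//; have [] := hB t Bt.
  rewrite ge0_integralD//.
  by rewrite integral_indic// setIT leeD2l.
have sub1 : (P [set t | (Theta t <= z)%R] <= P [set t | (U t <= zhi * s t)%R] + p%:E)%E.
  rewrite (@le_trans _ _ (P ([set t | (U t <= zhi * s t)%R] `|` B)))//.
    apply: le_measure; [exact/mem_set|apply/mem_set; exact: measurableU|].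
    move=> t /= h; have [Bt|Bt] := pselect (B t); first by right.
    left; have [s0 [rho hr hT]] := hB t Bt.
    have [+ _] := hw rho (U t / s t) hr; rewrite -hT => /(_ h).
    by rewrite ler_pdivrMr.
  by rewrite (le_trans (measureU2 _ _ _))// leeD2l.
have sub2 : (P [set t | (U t <= zlo * s t)%R] <= P [set t | (Theta t <= z)%R] + p%:E)%E.
  rewrite (@le_trans _ _ (P ([set t | (Theta t <= z)%R] `|` B)))//.
    apply: le_measure; [exact/mem_set|apply/mem_set; exact: measurableU|].
    move=> t /= h; have [Bt|Bt] := pselect (B t); first by right.
    left; have [s0 [rho hr hT]] := hB t Bt.
    have [_] := hw rho (U t / s t) hr; rewrite hT; apply.
    by rewrite ler_pdivrMr.
  by rewrite (le_trans (measureU2 _ _ _))// leeD2l.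
have := up zhi; have := down zlo; move: sub1 sub2.
rewrite -(fineK (fin_num_measure P _ mTh)) -(fineK (fin_num_measure P _ (mUy zlo)))
  -(fineK (fin_num_measure P _ (mUy zhi))).
rewrite -EFinB abse_EFin -!EFinD !lee_fin ler_norml => h1 h2 h3 h4.
by apply/andP; split; lra.
Qed.

End perturbation.

(** * The rate and the correlation ratio *)

Section rate.
Variable R : realType.
Notation rate n := (Num.sqrt (ln (n%:R : R)) / Num.sqrt n%:R).

(** [ln n = 2 * ln (Num.sqrt n) <= 2 * Num.sqrt n]. *)
Lemma rate_small (e0 : R) : 0 < e0 -> exists N : nat, forall n, (N <= n)%N -> rate n <= e0.
Proof.
move=> e0_gt0.
(* for these n one has 2 / e0 ^+ 2 <= Num.sqrt n *)
exists (Num.truncn (4 / e0 ^+ 4)).+1 => n Nn.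
have n0 : 0 < n%:R :> R by rewrite ltr0n (leq_trans _ Nn).
set q := Num.sqrt (n%:R : R).
have q0 : 0 < q by rewrite sqrtr_gt0.
have qn : q ^+ 2 = n%:R by rewrite sqr_sqrtr ?ler0n.
have big : 2 / e0 ^+ 2 <= q.
  rewrite -(@ler_pXn2r _ 2) ?nnegrE ?sqrtr_ge0 ?divr_ge0 ?exprn_ge0 ?(ltW e0_gt0)// qn.
  have -> : (2 / e0 ^+ 2) ^+ 2 = 4 / e0 ^+ 4 by field; rewrite gt_eqF.
  by rewrite (le_trans (ltW (truncnS_gt _)))// ler_nat.
have lnq : ln (n%:R : R) <= 2 * q.
  rewrite -qn lnXn// -[ln q *+ 2]mulr_natl ler_wpM2l//.
  have := @le_ln1Dx R (q - 1); rewrite (_ : 1 + (q - 1) = q); last by ring.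
  by move=> h; rewrite (le_trans (h _))//; lra.
rewrite ler_pdivrMr// -(@ler_pXn2r _ 2) ?nnegrE ?sqrtr_ge0 ?mulr_ge0//;
  rewrite ?(ltW e0_gt0) ?(ltW q0)//.
have [ln0|ln0] := leP 0 (ln (n%:R : R)); last first.
  by rewrite ler0_sqrtr ?(ltW ln0)// expr0n sqr_ge0.
rewrite sqr_sqrtr// (le_trans lnq)// exprMn.
have : 2 <= e0 ^+ 2 * q by rewrite mulrC -ler_pdivrMr// exprn_gt0.
by rewrite (expr2 q) mulrA => h; rewrite ler_wpM2r// ltW.
Qed.

Lemma inv_le_rate n : (1 < n)%N -> (n%:R : R)^-1 <= rate n.
Proof.
move=> n1; have n0 : 0 < n%:R :> R by rewrite ltr0n ltnW.
set q := Num.sqrt (n%:R : R).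
have q0 : 0 < q by rewrite sqrtr_gt0.
have qn : q ^+ 2 = n%:R by rewrite sqr_sqrtr ?ler0n.
have n2 : 2 <= n%:R :> R by rewrite ler_nat.
have nV : (n%:R : R)^-1 <= 2^-1 by rewrite lef_pV2 ?posrE.
have lnn : 2^-1 <= ln (n%:R : R).
  have := @le_ln1Dx R (n%:R^-1 - 1).
  rewrite (_ : 1 + (n%:R^-1 - 1) = n%:R^-1); last by ring.
  rewrite lnV ?posrE// => h.
  have : - ln (n%:R : R) <= n%:R^-1 - 1.
    by apply: h; rewrite ltrBrDl subrr invr_gt0.
  lra.
have ln0 : 0 <= ln (n%:R : R) by rewrite (le_trans _ lnn).
rewrite ler_pdivlMr// -qn expr2 invfM mulrVK ?unitfE ?gt_eqF//.
rewrite -(@ler_pXn2r _ 2) ?nnegrE ?sqrtr_ge0 ?invr_ge0 ?(ltW q0)//.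
rewrite sqr_sqrtr -expr2 qn// exprVn qn.
exact: le_trans nV lnn.
Qed.

End rate.

Lemma emp_cov_weights (R : realType) (alpha : R) (x f : nat -> R) n :
  emp_cov n x (ar1 alpha f) = n%:R^-1 * \sum_(k < n) centered_weight alpha n x k * f k.
Proof.
rewrite /emp_cov !big_add1/= !big_mkord -ar1_duality.
set S := \sum_(j < n) x j.+1.
under [in RHS]eq_bigr do rewrite mulrBl.
by rewrite sumrB -mulr_sumr -exprVn; ring.
Qed.

(** The factor is written with the normalized statistics, each of which tends
to 1. *)
Lemma emp_corr_ratio (R : realType) (alpha : R) (x y f : nat -> R) n :
  let beta := 1 - alpha ^+ 2 in
  let Q := \sum_(k < n) centered_weight alpha n x k ^+ 2 in
  (0 < n)%N -> 0 < beta -> y = ar1 alpha f ->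
  0 < Q -> 0 < emp_cov n x x -> 0 < emp_cov n y y ->
  Num.sqrt (beta / (1 + alpha ^+ 2)) * Num.sqrt n%:R * emp_corr n x y =
  Num.sqrt (beta ^+ 3 * (n%:R^-1 * Q) / (1 + alpha ^+ 2)
    / (beta * emp_cov n x x * (beta * emp_cov n y y))) *
  ((\sum_(k < n) centered_weight alpha n x k * f k) / Num.sqrt Q).
Proof.
move=> beta Q n0 b0 yE Q0 zx zy.
have N0 : 0 < n%:R :> R by rewrite ltr0n.
have a0 : 0 < 1 + alpha ^+ 2 by rewrite ltr_wpDr ?sqr_ge0.
rewrite /emp_corr {1}yE emp_cov_weights.
set U := \sum_(k < n) _ * f k; set z1 := emp_cov n x x in zx *.
set z2 := emp_cov n y y in zy *.
have z12 : 0 < z1 * z2 by rewrite mulr_gt0.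
suff : Num.sqrt (beta / (1 + alpha ^+ 2)) * Num.sqrt n%:R * n%:R^-1 / Num.sqrt (z1 * z2) =
  Num.sqrt (beta ^+ 3 * (n%:R^-1 * Q) / (1 + alpha ^+ 2)
    / (beta * z1 * (beta * z2))) / Num.sqrt Q.
  move=> h; transitivity (Num.sqrt (beta / (1 + alpha ^+ 2)) * Num.sqrt n%:R * n%:R^-1
    / Num.sqrt (z1 * z2) * U); first by ring.
  by rewrite h; ring.
apply/eqP; rewrite -(@eqrXn2 _ 2) ?mulr_ge0 ?invr_ge0 ?sqrtr_ge0 ?ler0n//.
have g0 : 0 <= beta / (1 + alpha ^+ 2) by rewrite divr_ge0 ?ltW.
rewrite !exprMn !exprVn !sqr_sqrtr ?ler0n ?(ltW Q0) ?(ltW z12)//; last first.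
  rewrite divr_ge0 ?divr_ge0 ?mulr_ge0 ?exprn_ge0 ?invr_ge0 ?ler0n ?(ltW Q0) ?(ltW b0)//;
    by rewrite ?(ltW a0) ?(ltW zx) ?(ltW zy).
by apply/eqP; field; rewrite !gt_eqF.
Qed.

(** * The empirical correlation *)

Section correlation.
Variable R : realType.
Variable alpha : R.
Hypothesis alpha_lt1 : `|alpha| < 1.
Notation beta := (1 - alpha ^+ 2).
Notation rate n := (Num.sqrt (ln (n%:R : R)) / Num.sqrt n%:R).
Notation scale := (Num.sqrt (beta / (1 + alpha ^+ 2))).

Let beta_gt0 : 0 < beta.
Proof. by rewrite subr_gt0 -(real_normK (num_real alpha)) expr_lt1. Qed.

Lemma measurable_centered_weight d (T : measurableType d) (x : nat -> T -> R) n k :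
  (forall i, measurable_fun setT (x i)) ->
  measurable_fun setT (fun t => centered_weight alpha n (x ^~ t) k).
Proof.
move=> mx; apply: measurable_sum => i; apply: measurable_funM => //.
apply: measurable_funB => //; apply: measurable_funM => //.
exact: measurable_sum.
Qed.

(** The condition [C * rate n <= 16^-1] keeps the three normalized statistics
positive and the rescaling error [delta = 8 * C * rate n] at most [2^-1]; the
good noise events of the two paths fail with probability [10 / n] each. *)
Lemma correlation_bound : exists D e0 : R, 0 < e0 /\
  forall (d : measure_display) (T : measurableType d) (P : probability T R)
    (xi eta : nat -> {RV P >-> R}),
  mutually_independent P (both_families xi eta) ->
  (forall i, has_law P (xi i) (normal_prob 0 1)) ->
  (forall i, has_law P (eta i) (normal_prob 0 1)) ->
  forall (n : nat) (z : R), (1 < n)%N -> rate n <= e0 ->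
  (`|P [set t | (scale * Num.sqrt n%:R * theta alpha xi eta n t <= z)%R] - (normal_cdf z)%:E|
    <= (D * rate n)%:E)%E.
Proof.
have [C C0 limits] := good_noise_limits alpha_lt1.
exists (16 * C + 40), (Num.min 4^-1 (Num.min (beta / 2) (16 * (C + 1))^-1)); split.
  by rewrite !lt_min !invr_gt0 divr_gt0//= ltr0n mulr_gt0//; lra.
move=> d T P xi eta ind lawxi laweta n z n1.
rewrite !le_min => /andP[e4 /andP[ebeta eC]].
have eps0 : 0 < rate n.
  by rewrite (lt_le_trans _ (inv_le_rate R n1))// invr_gt0 ltr0n ltnW.
have inl_inj : injective (@inl nat nat) by move=> i j [].
have inr_inj : injective (@inr nat nat) by move=> i j [].
have [B1 [mB1 PB1 good1]] :=
  @good_noise_probability _ _ _ _ _ _ ind _ inl_inj lawxi alpha n n1 e4.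
have [B2 [mB2 PB2 good2]] :=
  @good_noise_probability _ _ _ _ _ _ ind _ inr_inj laweta alpha n n1 e4.
pose x t := ar1 alpha (xi ^~ t); pose y t := ar1 alpha (eta ^~ t).
pose Q t := \sum_(k < n) centered_weight alpha n (x t) k ^+ 2.
pose U t := \sum_(k < n) centered_weight alpha n (x t) k * eta k t.
(* the whole first noise is known before any innovation of the second path *)
pose I (j : nat) : set (nat + nat) :=
  [set k | match k with inl _ => True | inr i => (i < j)%N end].
pose X := both_families xi eta.
have mxpast i : measurable_fun setT ((x ^~ i) : past X (I 0) -> R).
  by apply: measurable_ar1_lt => j _; exact: (@measurable_past _ _ _ _ _ X _ (inl j)).
have mwpast k : measurable_fun setT
    ((fun t => centered_weight alpha n (x t) k) : past X (I 0) -> R).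
  exact: (@measurable_centered_weight _ (past X (I 0)) (fun i t => x t i)).
have msqrt : measurable_fun setT (@Num.sqrt R).
  by apply: continuous_measurable_fun; exact: sqrt_continuous.
have mspast : measurable_fun setT ((fun t => Num.sqrt (Q t)) : past X (I 0) -> R).
  by apply: (measurableT_comp msqrt); apply: measurable_sum => k; exact: measurable_funX.
have mix a : (P [set t | (U t <= a * Num.sqrt (Q t))%R] =
    \int[P]_t normal_prob 0 1 [set u | (Num.sqrt (Q t) * u <= a * Num.sqrt (Q t))%R])%E.
  have fresh j : ~ I j (inr j) by rewrite /I/= ltnn.
  have mono j : I j `<=` I j.+1 by move=> [i|i] //= ij; exact: ltnW.
  have next j : I j.+1 (inr j) by rewrite /I/=.
  have mb : measurable_fun setT ((fun t => a * Num.sqrt (Q t)) : past X (I 0) -> R).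
    exact: measurable_funM.
  exact: (@gaussian_mixture _ _ _ _ _ X ind inr I fresh mono next laweta
    (fun k t => centered_weight alpha n (x t) k) _ n mwpast mb).
have h16 : C * rate n <= 16^-1.
  rewrite (@le_trans _ _ (C * (16 * (C + 1))^-1))//; first by rewrite ler_wpM2l.
  by rewrite invfM mulrCA ler_piMr// ler_pdivrMr ?mul1r; lra.
have delta : 0 <= 8 * (C * rate n) <= 2^-1.
  by rewrite !mulr_ge0 ?(ltW eps0)//=; lra.
have mB : measurable (B1 `|` B2) by exact: measurableU.
have PB : (P (B1 `|` B2) <= (20 * n%:R^-1)%:E)%E.
  rewrite (le_trans (measureU2 _ _ _))//.
  rewrite (le_trans (leeD PB1 PB2))// -EFinD lee_fin; lra.
have mTheta : measurable_fun setT (fun t => scale * Num.sqrt n%:R * theta alpha xi eta n t).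
  by apply: measurable_funM => //; exact: measurable_theta.
have mU : measurable_fun setT U.
  apply: measurable_sum => k; apply: measurable_funM => //.
  exact: past_fun (mwpast k).
have ms : measurable_fun setT (fun t => Num.sqrt (Q t)) by exact: past_fun mspast.
apply: (le_trans (@kolmogorov_perturbation _ _ _ P _ U (fun t => Num.sqrt (Q t))
  (B1 `|` B2) _ (20 * n%:R^-1) z mTheta mU ms mix delta mB PB _)); last first.
  by rewrite lee_fin; have := inv_le_rate R n1; lra.
move=> t /not_orP[/good1 g1 /good2 g2].
have n0 : (0 < n)%N by exact: ltnW.
have e1 : rate n <= 1 by rewrite (le_trans e4)//; lra.
have [zx q] := limits _ _ _ n0 eps0 e1 ebeta g1.
have [zy _] := limits _ _ _ n0 eps0 e1 ebeta g2.
have pos (w : R) : `|w - 1| <= C * rate n -> 0 < w.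
  by move=> /ler_normlP[]; lra.
have Q0 : 0 < Q t.
  have := pos _ q; rewrite pmulr_lgt0 ?invr_gt0 ?ltr_wpDr ?sqr_ge0//.
  by rewrite pmulr_rgt0 ?exprn_gt0// pmulr_rgt0// invr_gt0 ltr0n.
have zx0 : 0 < emp_cov n (x t) (x t) by have := pos _ zx; rewrite pmulr_rgt0.
have zy0 : 0 < emp_cov n (y t) (y t) by have := pos _ zy; rewrite pmulr_rgt0.
split; first by rewrite sqrtr_gt0.
have h4 : C * rate n <= 4^-1 by lra.
exists (Num.sqrt (beta ^+ 3 * (n%:R^-1 * Q t) / (1 + alpha ^+ 2)
    / (beta * emp_cov n (x t) (x t) * (beta * emp_cov n (y t) (y t))))).
  exact: sqrt_ratio_bound.
exact: (@emp_corr_ratio _ alpha (x t) (y t) (eta ^~ t)).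
Qed.

End correlation.

Theorem theorem17 (R : realType) (alpha : R) (alpha_lt1 : `|alpha| < 1) :
  exists (C : R) (N : nat),
    forall (d : measure_display) (T : measurableType d) (P : probability T R)
      (xi eta : nat -> {RV P >-> R}),
    mutually_independent P (both_families xi eta) ->
    (forall i, has_law P (xi i) (normal_prob 0 1)) ->
    (forall i, has_law P (eta i) (normal_prob 0 1)) ->
    (forall n : nat, (N <= n)%N ->
      (dKol
        (distribution P
          ((Num.sqrt ((1 - alpha ^+ 2) / (1 + alpha ^+ 2)) * Num.sqrt n%:R)
             *: (theta alpha xi eta n : {RV P >-> R})))
        (normal_prob 0 1)
       <= (C * (Num.sqrt (ln n%:R) / Num.sqrt n%:R))%:E)%E) /\
    cvg_in_distribution
      (fun n => distribution P
        (Num.sqrt n%:R *: (theta alpha xi eta n : {RV P >-> R})))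
      (normal_prob 0 (Num.sqrt ((1 + alpha ^+ 2) / (1 - alpha ^+ 2)))).
Proof.
have [D [e0 [e0_gt0 bound]]] := correlation_bound alpha_lt1.
have [N0 small] := rate_small e0_gt0.
exists D, (maxn 2 N0) => d T P xi eta ind lawxi laweta.
have key n z : (maxn 2 N0 <= n)%N -> (`|P [set t |
    (Num.sqrt ((1 - alpha ^+ 2) / (1 + alpha ^+ 2)) * Num.sqrt n%:R * theta alpha xi eta n t <= z)%R]
    - (normal_cdf z)%:E| <= (D * (Num.sqrt (ln n%:R) / Num.sqrt n%:R))%:E)%E.
  by rewrite geq_max => /andP[n2 nN]; apply: bound => //; exact: small.
split=> [n Nn|z _].
  by apply: ge_ereal_sup => _ [z _ <-]; rewrite -normal_cdfE; exact: key.
have b0 : 0 < 1 - alpha ^+ 2.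
  by rewrite subr_gt0 -(real_normK (num_real alpha)) expr_lt1.
have a0 : 0 < 1 + alpha ^+ 2 by rewrite ltr_wpDr ?sqr_ge0.
set c := Num.sqrt ((1 - alpha ^+ 2) / (1 + alpha ^+ 2)) in key *.
have c0 : 0 < c by rewrite sqrtr_gt0 divr_gt0.
have -> : Num.sqrt ((1 + alpha ^+ 2) / (1 - alpha ^+ 2)) = c^-1.
  by rewrite /c -sqrtrV ?divr_ge0 ?(ltW a0) ?(ltW b0)// invf_div.
rewrite normal_prob_scale ?invr_gt0// invrK.
pose p n := fine (P [set t | Num.sqrt n%:R * theta alpha xi eta n t <= z]).
have mE n : measurable [set t | Num.sqrt n%:R * theta alpha xi eta n t <= z].
  rewrite -[X in measurable X]setTI; apply: measurable_fun_le => //.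
  by apply: measurable_funM => //; exact: measurable_theta.
rewrite (_ : (fun n => _) = (fun n => (p n)%:E)); last first.
  by apply/funext => n; rewrite /p fineK// fin_num_measure.
have pbound n : (maxn 2 N0 <= n)%N ->
    `|normal_cdf (z * c) - p n| <= D * (Num.sqrt (ln n%:R) / Num.sqrt n%:R).
  move=> Nn; have := key n (z * c) Nn.
  rewrite (_ : [set t | _] = [set t | Num.sqrt n%:R * theta alpha xi eta n t <= z]); last first.
    by apply/seteqP; split=> t /=; rewrite -mulrA (mulrC z) ler_pM2l.
  rewrite -(fineK (fin_num_measure P _ (mE n))) -EFinB abse_EFin lee_fin.
  by rewrite distrC.
apply: cvg_EFin; first by near=> n.
apply/cvgrPdist_le => e e_gt0.
have D1 : 0 < `|D| + 1 by rewrite ltr_wpDl.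
have [N1 hN1] := rate_small (divr_gt0 e_gt0 D1).
near=> n.
rewrite /= (le_trans (pbound n _))//; first by near: n; exact: nbhs_infty_ge.
have r0 : 0 <= Num.sqrt (ln n%:R) / Num.sqrt n%:R :> R by rewrite divr_ge0 ?sqrtr_ge0.
rewrite (@le_trans _ _ ((`|D| + 1) * (Num.sqrt (ln n%:R) / Num.sqrt n%:R)))//.
  by rewrite ler_wpM2r// (le_trans (ler_norm _))// lerDl.
by rewrite mulrC -ler_pdivlMr//; apply: hN1; near: n; exact: nbhs_infty_ge.
Unshelve. all: by end_near.
Qed.
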